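(* Let $U=(u_1,\dots,u_m)\in\mathcal{U}(n,m)$. Then $C_{\mathrm{cv}}(U)=P_{\mathrm{scc}}(U)$ if and only if $m=2n$ and, up to renumbering of the columns, $u_{n+i}=-u_i$ for $1\le i\le n$.
   Context: $\mathcal{U}(n,m)$ denotes the set of all matrices $U=(u_1,\dots,u_m)$ whose columns $u_i\in\mathbb{S}^{n-1}\subset\mathbb{R}^n$ are pairwise distinct unit vectors with $\operatorname{pos}U=\mathbb{R}^n$ (every vector of $\mathbb{R}^n$ is a non-negative linear combination of the $u_i$). $U$ is also identified with the set $\{u_1,\dots,u_m\}$. For $b\in\mathbb{R}^m_{\ge0}$ let $P(U,b)=\{x\in\mathbb{R}^n:\langle u_i,x\rangle\le b_i,\ 1\le i\le m\}$, $F_i(b)=P(U,b)\cap\{x:\langle u_i,x\rangle=b_i\}$ (possibly empty), and define the cone-volume vector $\gamma(U,b)=\frac1n\big(b_1\operatorname{vol}_{n-1}(F_1(b)),\dots,b_m\operatorname{vol}_{n-1}(F_m(b))\big)^\intercal\in\mathbb{R}^m_{\ge0}$, where $\operatorname{vol}_{n-1}$ is $(n-1)$-dimensional Lebesgue measure in the respective hyperplane. The cone-volume set is $C_{\mathrm{cv}}(U)=\{\gamma(U,b):b\in\mathbb{R}^m_{\ge0},\ \operatorname{vol}(P(U,b))=1\}$. Subspace concentration polytope: let $\mathcal{B}(U)$ be the set of all subsets of $\{u_1,\dots,u_m\}$ forming a basis of $\mathbb{R}^n$, and for $B\in\mathcal{B}(U)$ let $\chi_U(B)\in\{0,1\}^m$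 be its characteristic vector ($i$-th entry $1$ iff $u_i\in B$). Then $P_{\mathrm{scc}}(U)=\frac1n\operatorname{conv}\{\chi_U(B):B\in\mathcal{B}(U)\}\subset\mathbb{R}^m$. *)

(* Defs.v *)
From HB Require Import structures.
From mathcomp Require Import all_boot all_order all_fingroup all_algebra.
From mathcomp Require Import all_classical all_reals all_analysis.
Set Implicit Arguments.
Unset Strict Implicit.
Unset Printing Implicit Defensive.
Import Order.TTheory GRing.Theory Num.Theory.
Import numFieldNormedType.Exports.

Local Open Scope classical_set_scope.
Local Open Scope ring_scope.

(* [measurableTypeR R] is [R] with the Borel sigma-algebra, the type on which
   the library defines [lebesgue_measure]; [n.-tuple _] carries the product
   sigma-algebra. *)
Section lebesgue_measure_cons.
Context (R : realType) (n : nat).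
Local Notation T := (measurableTypeR R).
Variable mu : {sigma_finite_measure set (n.-tuple T) -> \bar R}.

Definition tuple_cons (p : T * n.-tuple T) : n.+1.-tuple T :=
  [the n.+1.-tuple T of p.1 :: p.2].

Lemma measurable_tuple_cons : measurable_fun setT tuple_cons.
Proof. exact: measurable_cons. Qed.

Definition lebesgue_measure_cons : set (n.+1.-tuple T) -> \bar R :=
  pushforward (@lebesgue_measure R \x mu)%E tuple_cons.

Let cons0 : lebesgue_measure_cons set0 = 0%E.
Proof. by rewrite /lebesgue_measure_cons /pushforward preimage_set0 measure0. Qed.

Let cons_ge0 A : (0 <= lebesgue_measure_cons A)%E.
Proof. exact: (measure_ge0 (@lebesgue_measure R \x mu)%E). Qed.

Let mpre A : measurable A -> measurable (tuple_cons @^-1` A).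
Proof. by move=> mA; rewrite -[X in measurable X]setTI; exact: measurable_tuple_cons. Qed.

Let cons_sigma_additive : semi_sigma_additive lebesgue_measure_cons.
Proof.
move=> F mF tF mUF; rewrite /lebesgue_measure_cons /pushforward preimage_bigcup.
apply: measure_semi_sigma_additive.
- by move=> k; exact: mpre.
- apply/trivIsetP => /= i j _ _ ij; rewrite -preimage_setI.
  by move/trivIsetP : tF => /(_ _ _ _ _ ij) ->//; rewrite preimage_set0.
- by rewrite -preimage_bigcup; exact: mpre.
Qed.

HB.instance Definition _ := isMeasure.Build _ _ _
  lebesgue_measure_cons cons0 cons_ge0 cons_sigma_additive.

Let uncons (t : n.+1.-tuple T) : T * n.-tuple T := (thead t, [tuple of behead t]).

Let measurable_uncons : measurable_fun setT uncons.
Proof.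
apply/measurable_fun_pairP; split.
  exact: (@measurable_tnth _ T n.+1 ord0).
exact: measurable_behead.
Qed.

Let tuple_consK : cancel tuple_cons uncons.
Proof. by move=> [x t]; congr pair => //; apply/val_inj. Qed.

(* The library proves this, but the canonical instance it exports for [\x] only
   applies to finite measures. *)
Let prod_sigma_finite : sigma_finite setT (@lebesgue_measure R \x mu)%E.
Proof.
have /sigma_finiteP[F [TF ndF Foo]] := sigma_finiteT (@lebesgue_measure R).
have /sigma_finiteP[G [TG ndG Goo]] := sigma_finiteT mu.
exists (fun k => F k `*` G k).
  rewrite -setXTT TF TG predeqE => -[x y]; split.
    move=> [/= [i _ Fix] [k _ Gky]]; exists (maxn i k) => //; split.
    - by move: x Fix; exact/subsetPset/ndF/leq_maxl.
    - by move: y Gky; exact/subsetPset/ndG/leq_maxr.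
  by move=> [i _ []/= ? ?]; split; exists i.
move=> k; have [? ?] := Foo k; have [? ?] := Goo k.
split; first exact: measurableX.
by rewrite product_measure1E// lte_mul_pinfty// ge0_fin_numE.
Qed.

Let cons_sigma_finite : sigma_finite setT lebesgue_measure_cons.
Proof.
have [F FT Foo] := prod_sigma_finite.
exists (fun k => uncons @^-1` F k) => [|k].
  by rewrite -preimage_bigcup -FT preimage_setT.
have [mF Fk] := Foo k; split.
  by rewrite -[X in measurable X]setTI; exact: measurable_uncons.
rewrite /lebesgue_measure_cons /pushforward -comp_preimage.
by rewrite (_ : uncons \o tuple_cons = id)//; exact/funext/tuple_consK.
Qed.

HB.instance Definition _ := Measure_isSigmaFinite.Build _ _ _
  lebesgue_measure_cons cons_sigma_finite.

End lebesgue_measure_cons.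

(* n-dimensional Lebesgue measure, as the n-fold product of the one-dimensional
   one (for n = 0, the unit mass on the only point). *)
Fixpoint lebesgue_measure_tuple (R : realType) (n : nat) :
    {sigma_finite_measure set (n.-tuple (measurableTypeR R)) -> \bar R} :=
  match n with
  | 0 => dirac [tuple]
  | k.+1 => lebesgue_measure_cons (lebesgue_measure_tuple R k)
  end.

Section geometry.
Context (R : realType).

Definition vol n (A : set 'cV[R]_n) : \bar R :=
  lebesgue_measure_tuple R n [set t | A (\col_i tnth t i)].

Definition dot n (x y : 'cV[R]_n) : R := \sum_i x i 0 * y i 0.

(* The library's norm on matrices is the sup norm. *)
Definition enorm n (x : 'cV[R]_n) : R := Num.sqrt (dot x x).

Definition pos_hull n m (U : 'M[R]_(n, m)) : set 'cV[R]_n :=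
  [set x | exists c : 'I_m -> R,
     (forall i, 0 <= c i) /\ x = \sum_i c i *: col i U].

Definition conv_hull (V : lmodType R) (A : set V) : set V :=
  [set x | exists (k : nat) (c : 'I_k -> R) (v : 'I_k -> V),
     [/\ forall i, 0 <= c i, \sum_i c i = 1, forall i, A (v i)
       & x = \sum_i c i *: v i]].

(* A matrix whose columns are an orthonormal basis of the orthogonal complement
   of the unit vector u, so that y |-> b *: u + Q *m y is an isometry from
   R^(n-1) onto the hyperplane <u, x> = b. Such matrices exist, and by the
   invariance of Lebesgue measure under isometries the choice among them does
   not affect [hyperplane_vol]. *)
Definition hyperplane_frame n (u : 'cV[R]_n) : 'M[R]_(n, n.-1) :=
  xget 0 [set Q : 'M[R]_(n, n.-1) | Q^T *m Q = 1%:M /\ Q^T *m u = 0].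

(* (n-1)-dimensional Lebesgue measure in the hyperplane <u, x> = b *)
Definition hyperplane_vol n (u : 'cV[R]_n) (b : R) (A : set 'cV[R]_n) : \bar R :=
  vol [set y | A (b *: u + hyperplane_frame u *m y)].

Context (n m : nat) (U : 'M[R]_(n, m)).

Definition in_calU : Prop :=
  [/\ forall i, enorm (col i U) = 1,
      injective (fun i => col i U)
    & pos_hull U = setT].

Definition polytope (b : 'cV[R]_m) : set 'cV[R]_n :=
  [set x | forall i, dot (col i U) x <= b i 0].

Definition facet (b : 'cV[R]_m) (i : 'I_m) : set 'cV[R]_n :=
  polytope b `&` [set x | dot (col i U) x = b i 0].

(* [fine] loses nothing: if pos U = R^n, then [polytope b] is bounded. *)
Definition cone_volume (b : 'cV[R]_m) : 'cV[R]_m :=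
  n%:R^-1 *: \col_i (b i 0 * fine (hyperplane_vol (col i U) (b i 0) (facet b i))).

Definition Ccv : set 'cV[R]_m :=
  [set cone_volume b | b in
     [set b : 'cV[R]_m | (forall i, 0 <= b i 0) /\ vol (polytope b) = 1%E]].

(* A subset of {u_1, ..., u_m} is given by its set of indices, which is
   faithful since the u_i are pairwise distinct. *)
Definition is_basis_set (B : {set 'I_m}) : bool :=
  basis_of fullv [seq col i U | i <- enum B].

Definition char_vec (B : {set 'I_m}) : 'cV[R]_m := \col_i (i \in B)%:R.

Definition Pscc : set 'cV[R]_m :=
  [set n%:R^-1 *: x | x in
     conv_hull [set char_vec B | B in [set B | is_basis_set B]]].

End geometry.

(* Main.v *)
Require Import Defs.
From mathcomp Require Import all_boot all_order all_fingroup all_algebra.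
From mathcomp Require Import all_classical all_reals all_analysis.
From mathcomp Require Import measurable_realfun lebesgue_integral_nonneg.
From mathcomp Require Import ring lra.
Set Implicit Arguments.
Unset Strict Implicit.
Unset Printing Implicit Defensive.
Import Order.TTheory GRing.Theory Num.Theory.
Import numFieldNormedType.Exports.
Local Open Scope classical_set_scope.
Local Open Scope ring_scope.

(* Every point of Pscc has entries at most 1/n, so Ccv = Pscc forces
   b_i vol(F_i) <= vol(P) for all b. Suppose -u_i is a positive combination of
   linearly independent u_j (j in J), not all parallel to u_i. Put b_j = 0 on J,
   b_i = t, and b_k = 1 otherwise: then P(t) lies in 0 <= <u_i,x> <= t, the slice
   at height s <= t is the facet F_i(s), and t vol(F_i(t)) <= vol(P(t)) is the
   integral of vol(F_i(s)) over [0,t], whereas vol(F_i(s)) = O(s); iterating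
   gives vol(P(t)) = 0, a contradiction. By Caratheodory -u_i is therefore itself
   in U, and writing -u_i over a basis of U with signs absorbed into U shows that
   U consists of a basis and its opposite.
   Conversely, for such U every P is a parallelepiped and Fubini gives
   vol(P) = (b_i + b_i') vol(F_i), where u_i' = -u_i; hence Ccv is the set of
   points p/n with p >= 0 and p_i + p_i' = 1, a product of segments whose
   vertices are the bases contained in U.
   Slicing along u_i needs Lebesgue measure to be rotation invariant. By Fubini a
   translation invariant measure is a multiple of Lebesgue measure, and a rotation
   fixes the unit ball. *)

(** * Lebesgue measure on column vectors *)

Section volume.
Variable R : realType.
Local Notation T := (measurableTypeR R).

Definition col_of_tuple n (t : n.-tuple T) : 'cV[R]_n := \col_i tnth t i.

Definition tuple_of_col n (x : 'cV[R]_n) : n.-tuple T := [tuple x i 0 | i < n].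

Lemma tuple_of_colK n : cancel (@tuple_of_col n) (@col_of_tuple n).
Proof. by move=> x; apply/colP => i; rewrite !mxE tnth_mktuple. Qed.

(** This is measurability of the very set of tuples whose measure defines [vol A]. *)
Definition colmeasurable n (A : set 'cV[R]_n) : Prop :=
  measurable (@col_of_tuple n @^-1` A).

Lemma measurable_preimage_col d (X : measurableType d) n (f : X -> 'cV[R]_n)
    (A : set 'cV[R]_n) :
  (forall i, measurable_fun [set: X] (fun x => f x i 0 : T)) ->
  colmeasurable A -> measurable (f @^-1` A).
Proof.
move=> mf mA.
have mg : measurable_fun [set: X] (@tuple_of_col n \o f).
  apply/measurable_fun_tnthP => i.
  by apply: eq_measurable_fun (mf i) => x _; rewrite /= tnth_mktuple.
have := mg measurableT _ mA; rewrite setTI.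
by congr measurable; apply/seteqP; split => x /=; rewrite tuple_of_colK.
Qed.

Lemma measurable_col_of_tuple n (i : 'I_n) :
  measurable_fun [set: n.-tuple T] (fun t => col_of_tuple t i 0 : T).
Proof.
by apply: eq_measurable_fun (measurable_tnth i) => t _; rewrite mxE.
Qed.

Lemma measurable_mulmx_col d (X : measurableType d) n k (M : 'M[R]_(k, n))
    (f : X -> 'cV[R]_n) :
  (forall i, measurable_fun [set: X] (fun x => f x i 0 : T)) ->
  forall i, measurable_fun [set: X] (fun x => (M *m f x) i 0 : T).
Proof.
move=> mf i; rewrite [X in measurable_fun _ X](_ : _ =
  fun x => \sum_j M i j * f x j 0); last by apply/funext => x; rewrite !mxE.
apply: measurable_sum => j.
by apply: measurable_funM => //; exact: mf.
Qed.

Lemma measurable_add_col d (X : measurableType d) n (f g : X -> 'cV[R]_n) :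
  (forall i, measurable_fun [set: X] (fun x => f x i 0 : T)) ->
  (forall i, measurable_fun [set: X] (fun x => g x i 0 : T)) ->
  forall i, measurable_fun [set: X] (fun x => (f x + g x) i 0 : T).
Proof.
move=> mf mg i; rewrite [X in measurable_fun _ X](_ : _ =
  (fun x => f x i 0) \+ (fun x => g x i 0)); last first.
  by apply/funext => x; rewrite !mxE.
by apply: measurable_funD; [exact: mf|exact: mg].
Qed.

Lemma colmeasurable_dot_le n (u : 'cV[R]_n) b :
  colmeasurable [set x | dot u x <= b].
Proof.
rewrite /colmeasurable (_ : _ @^-1` _ =
  (fun t => \sum_i u i 0 * tnth t i) @^-1` `]-oo, b]); last first.
  apply/funext => t; rewrite /= in_itv/= /dot; congr (is_true (_ <= _)).
  by apply: eq_bigr => i _; rewrite mxE.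
rewrite -[X in measurable X]setTI.
have mf : measurable_fun [set: n.-tuple T] (fun t => \sum_i u i 0 * tnth t i).
  apply: measurable_sum => i; apply: measurable_funM => //.
  exact: measurable_tnth.
exact: mf.
Qed.

Lemma colmeasurable_forall n (I : finType) (A : I -> set 'cV[R]_n) :
  (forall i, colmeasurable (A i)) -> colmeasurable [set x | forall i, A i x].
Proof.
move=> mA; rewrite /colmeasurable (_ : _ @^-1` _ =
  \bigcap_(i in [set: I]) (@col_of_tuple n @^-1` A i)); last first.
  by apply/seteqP; split => t /= At i; [move=> _; exact: At|exact: At].
apply: fin_bigcap_measurable => [|i _]; [exact: finite_finset|exact: mA].
Qed.

Lemma le_vol n (A B : set 'cV[R]_n) : colmeasurable A -> colmeasurable B ->
  A `<=` B -> (vol A <= vol B)%E.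
Proof.
by move=> mA mB AB; apply: le_measure; rewrite ?inE// => t; exact: AB.
Qed.

Lemma vol_ge0 n (A : set 'cV[R]_n) : (0 <= vol A)%E.
Proof. exact: measure_ge0. Qed.

Lemma vol_set0 n : vol (set0 : set 'cV[R]_n) = 0%E.
Proof. exact: measure0. Qed.

Lemma col_of_tuple_cons n (s : T) (t : n.-tuple T) :
  col_of_tuple (tuple_cons (s, t)) = col_mx s%:M (col_of_tuple t) :> 'cV_(1 + n).
Proof.
apply/colP => i; rewrite !mxE; case: split_ordP => j ->.
  by rewrite ord1 !mxE mulr1n /=.
rewrite !mxE /tuple_cons/=.
by rewrite !(tnth_nth s).
Qed.

Lemma xsection_tuple_cons n (A : set 'cV[R]_n.+1) (s : T) :
  xsection (@tuple_cons R n @^-1` (@col_of_tuple n.+1 @^-1` A)) s =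
  @col_of_tuple n @^-1` [set y | A (col_mx s%:M y : 'cV_(1 + n))].
Proof.
apply/funext => t; apply/propext; rewrite /xsection/= inE/=.
by rewrite col_of_tuple_cons.
Qed.

Lemma measurable_tuple_cons_preimage n (A : set 'cV[R]_n.+1) :
  colmeasurable A ->
  measurable (@tuple_cons R n @^-1` (@col_of_tuple n.+1 @^-1` A)).
Proof.
by move=> mA; rewrite -[X in measurable X]setTI; exact: measurable_tuple_cons.
Qed.

Lemma colmeasurable_slice n (A : set 'cV[R]_n.+1) (s : T) : colmeasurable A ->
  colmeasurable [set y : 'cV[R]_n | A (col_mx s%:M y : 'cV_(1 + n))].
Proof.
move=> /measurable_tuple_cons_preimage /(measurable_xsection s).
by rewrite xsection_tuple_cons.
Qed.

(** Tonelli holds by construction: the measure is the pushforward of a product measure, whose value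
    is the integral of the measures of the sections. *)
Lemma vol_succ n (A : set 'cV[R]_n.+1) :
  vol A = (\int[lebesgue_measure]_(s in [set: T])
            vol [set y : 'cV[R]_n | A (col_mx s%:M y : 'cV_(1 + n))])%E.
Proof.
rewrite /vol/= /lebesgue_measure_cons /pushforward /product_measure1.
by apply: eq_integral => s _ /=; rewrite xsection_tuple_cons.
Qed.

Lemma measurable_vol_slice n (A : set 'cV[R]_n.+1) : colmeasurable A ->
  measurable_fun [set: T]
    (fun s : T => vol [set y : 'cV[R]_n | A (col_mx s%:M y : 'cV_(1 + n))]).
Proof.
move=> /measurable_tuple_cons_preimage.
move=> /(measurable_fun_xsection (lebesgue_measure_tuple R n)).
by apply: eq_measurable_fun => s _ /=; rewrite xsection_tuple_cons.
Qed.

End volume.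

(** * Translations and linear maps *)

Section volume_invariance.
Variable R : realType.
Local Notation T := (measurableTypeR R).

Lemma colmeasurable_preimage n (f : 'cV[R]_n -> R) (B : set R) :
  measurable_fun [set: n.-tuple T] (fun t => f (col_of_tuple t) : T) ->
  measurable B -> colmeasurable (f @^-1` B).
Proof.
by move=> mf mB; rewrite /colmeasurable -[X in measurable X]setTI; exact: mf.
Qed.

Lemma colmeasurable_coord n (i : 'I_n) (J : interval R) :
  colmeasurable [set x | x i 0 \in J].
Proof.
exact: (colmeasurable_preimage (f := fun x : 'cV[R]_n => x i 0)
  (@measurable_col_of_tuple R n i) (measurable_itv J)).
Qed.

Lemma colmeasurable_affine n k (M : 'M[R]_(n, k)) v (A : set 'cV[R]_n) :
  colmeasurable A -> colmeasurable [set y | A (v + M *m y)].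
Proof.
move=> mA; apply: (@measurable_preimage_col R _ _ n
  (fun t => v + M *m col_of_tuple t)) => // i.
apply: measurable_add_col => // {}i.
by apply: measurable_mulmx_col => {}i; exact: measurable_col_of_tuple.
Qed.

Lemma colmeasurableI n (A B : set 'cV[R]_n) :
  colmeasurable A -> colmeasurable B -> colmeasurable (A `&` B).
Proof. exact: measurableI. Qed.

(** Uniqueness of Lebesgue measure reduces the claim to half-open intervals, whose length a shift
    preserves. *)
Lemma lebesgue_measure_shift (a : R) (A : set T) : measurable A ->
  pushforward lebesgue_measure (fun x => x + a : T) A = lebesgue_measure A.
Proof.
move=> mA; apply/esym/lebesgue_measure_unique => //=.
  by apply: measurable_funD.
move=> _ _ [[b c]] _ <-.
rewrite /pushforward (_ : _ @^-1` _ = `]b - a, c - a]%classic); last first.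
  by apply/seteqP; split => x; rewrite /= !in_itv/= ltrBlDr lerBrDr.
rewrite !lebesgue_measure_itv/= !lte_fin ltrD2r; case: ifPn => // _.
by rewrite -!EFinB; congr (_%:E); ring.
Qed.

Lemma ge0_integral_shift (a : R) (f : T -> \bar R) :
  measurable_fun [set: T] f -> (forall x, 0 <= f x)%E ->
  (\int[lebesgue_measure]_(x in [set: T]) f (x + a)%R =
   \int[lebesgue_measure]_(x in [set: T]) f x)%E.
Proof.
move=> mf f0.
have mphi : measurable_fun [set: T] (fun x : T => x + a : T).
  by apply: measurable_funD.
have := @ge0_integral_pushforward _ _ _ _ R _ mphi lebesgue_measure _ f
  measurableT mf (fun y _ => f0 y).
rewrite preimage_setT => <-.
by apply: eq_measure_integral => /= A mA _; exact: lebesgue_measure_shift.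
Qed.

(** Induction on the dimension: the integral over slices absorbs the shift of the first coordinate,
    the induction hypothesis that of the others. *)
Lemma vol_translate n (v : 'cV[R]_n) A : colmeasurable A ->
  vol [set x | A (x + v)] = vol A.
Proof.
elim: n => [|n IH] in v A *.
  by move=> _; congr vol; apply/funext => x /=; congr A;
    rewrite !flatmx0.
move=> mA; rewrite !vol_succ.
pose a := v 0 0; pose w : 'cV[R]_n := dsubmx (v : 'cV_(1 + n)).
have vE : v = col_mx a%:M w :> 'cV_(1 + n).
  rewrite -[LHS](@vsubmxK _ 1 n); congr col_mx.
  apply/colP => i; rewrite ord1 !mxE mulr1n /a; congr (v _ _).
  exact/val_inj.
rewrite -[RHS](ge0_integral_shift a); last 2 first.
- exact: measurable_vol_slice.
- by move=> x; exact: vol_ge0.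
apply: eq_integral => s _.
rewrite -[RHS](IH w); last exact: colmeasurable_slice.
congr vol; apply/funext => y /=; congr A.
rewrite vE (_ : (s + a)%:M = s%:M + a%:M :> 'M[R]_1); last exact: raddfD.
exact: (add_col_mx (s%:M : 'M[R]_1) y a%:M w).
Qed.

Lemma forall_col_mx n (P : R -> Prop) s (y : 'cV[R]_n) :
  (forall i : 'I_n.+1, P ((col_mx s%:M y : 'cV_(1 + n)) i 0)) <->
  P s /\ forall i, P (y i 0).
Proof.
have e0 : col_mx (s%:M : 'M[R]_1) y (lshift n 0) 0 = s.
  by rewrite col_mxEu mxE mulr1n.
have e1 i : col_mx (s%:M : 'M[R]_1) y (rshift 1 i) 0 = y i 0 by rewrite col_mxEd.
split=> [H|[H0 H1] i].
  split=> [|i]; first by rewrite -e0; exact: (H (lshift n (0 : 'I_1))).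
  by rewrite -e1; exact: (H (rshift 1 i)).
case: (split_ordP (i : 'I_(1 + n))) => j ->; last by rewrite e1.
by rewrite ord1 e0.
Qed.

Definition cube n (c : R) : set 'cV[R]_n := [set x | forall i, x i 0 \in `[0, c]].
Arguments cube : clear implicits.

Lemma colmeasurable_cube n c : colmeasurable (cube n c).
Proof. by apply: colmeasurable_forall => i; exact: colmeasurable_coord. Qed.

Lemma vol_cube n c : 0 <= c -> vol (cube n c) = (c ^+ n)%:E.
Proof.
move=> c0; elim: n => [|n IH].
  rewrite /vol/= expr0 diracE; rewrite mem_set//.
  by move=> [].
rewrite vol_succ.
transitivity (\int[lebesgue_measure]_(s in `[0%R, c]) (cst (c ^+ n)%:E s))%E.
  rewrite [RHS]integral_mkcond; apply: eq_integral => s _.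
  rewrite patchE mem_setE; case: ifPn => sc /=.
    rewrite -IH; congr vol; apply/funext => y; apply/propext.
    by split => [/(forall_col_mx (fun z => z \in `[0, c]))[]|H] //;
      apply/(forall_col_mx (fun z => z \in `[0, c])).
  rewrite -[RHS](@vol_set0 R n); congr vol; apply/funext => y; apply/propext.
  by split => // /(forall_col_mx (fun z => z \in `[0, c]))[]; rewrite (negPf sc).
rewrite (@integral_cst _ T)//.
rewrite exprSr EFinM; congr (_ * _)%E.
rewrite [LHS](lebesgue_measure_itv `[0, c])/= lte_fin.
by case: ltgtP c0 => // [c0 _|<-]; first by rewrite oppr0 adde0.
Qed.

Lemma vol_fubini n k (E : 'cV[R]_n -> 'cV[R]_k -> Prop) :
  measurable [set p : n.-tuple T * k.-tuple T |
               E (col_of_tuple p.1) (col_of_tuple p.2)] ->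
  (\int[lebesgue_measure_tuple R n]_x vol [set y | E (col_of_tuple x) y] =
   \int[lebesgue_measure_tuple R k]_y vol [set x | E x (col_of_tuple y)])%E.
Proof.
move=> mE; have := indic_fubini_tonelli (lebesgue_measure_tuple R n)
  (lebesgue_measure_tuple R k) mE.
rewrite indic_fubini_tonelli_FE// indic_fubini_tonelli_GE// => EFG.
transitivity (\int[lebesgue_measure_tuple R n]_x
  (lebesgue_measure_tuple R k \o xsection [set p |
     E (col_of_tuple p.1) (col_of_tuple p.2)]) x)%E.
  apply: eq_integral => x _ /=; congr (lebesgue_measure_tuple _ _ _).
  by apply/funext => y; apply/propext; rewrite /xsection/= inE.
rewrite EFG; apply: eq_integral => x _ /=; congr (lebesgue_measure_tuple _ _ _).
by apply/funext => y; apply/propext; rewrite /ysection/= inE.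
Qed.

Lemma integral_if_vol n (A : set 'cV[R]_n) (c : \bar R) : colmeasurable A ->
  (0 <= c)%E ->
  (\int[lebesgue_measure_tuple R n]_x
     (if col_of_tuple x \in A then c else 0) = vol A * c)%E.
Proof.
move=> mA c0.
transitivity (\int[lebesgue_measure_tuple R n]_x
  ((\1_(@col_of_tuple R n @^-1` A) x)%:E * c))%E.
  apply: eq_integral => x _; rewrite indicE.
  rewrite (_ : (x \in _) = (col_of_tuple x \in A)); last first.
    by apply/idP/idP; rewrite !inE.
  by case: ifP => _; rewrite ?mul1e ?mul0e.
rewrite ge0_integralZr//; last exact: measurableT_comp.
by rewrite integral_indic// setIT.
Qed.

(* Compare the slices of {(x, y) | A (L x), B (y + L x)}, after translating x by
   - M y so that the conditions become A (L x - y) and B (L x). *)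
Lemma vol_linear_neg n (L M : 'M[R]_n) A B : L *m M = 1%:M ->
  colmeasurable A -> colmeasurable B ->
  (vol [set x | A (L *m x)] * vol B =
   vol [set x | B (L *m x)] * vol [set x | A (- x)%R])%E.
Proof.
move=> LM mA mB.
have mL (C : set 'cV[R]_n) : colmeasurable C ->
    colmeasurable [set x | C (L *m x)].
  move=> mC; rewrite (_ : [set _ | _] = [set x | C (0 + L *m x)]).
    exact: colmeasurable_affine.
  by apply/funext => x /=; rewrite add0r.
have mN (z : 'cV[R]_n) : colmeasurable [set x | A (z - x)].
  rewrite (_ : [set _ | _] = [set x | A (z + (- 1%:M) *m x)]).
    exact: colmeasurable_affine.
  by apply/funext => x /=; rewrite mulNmx mul1mx.
have mf i : measurable_fun [set: n.-tuple T * n.-tuple T]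
    (fun p => (L *m col_of_tuple p.1) i 0 : T).
  apply: measurable_mulmx_col => {}i.
  exact: (measurableT_comp (@measurable_col_of_tuple R n i) measurable_fst).
have ms i : measurable_fun [set: n.-tuple T * n.-tuple T]
    (fun p => (col_of_tuple p.2) i 0 : T).
  exact: (measurableT_comp (@measurable_col_of_tuple R n i) measurable_snd).
have N0 : vol [set x | A (- x)] = vol [set x | A (0 - x)].
  by congr vol; apply/funext => x /=; rewrite sub0r.
transitivity (\int[lebesgue_measure_tuple R n]_x
   vol [set y | A (L *m col_of_tuple x) /\ B (y + L *m col_of_tuple x)%R])%E.
  rewrite -integral_if_vol//; last exact: mL.
  apply: eq_integral => x _; case: ifPn => Ax; first rewrite inE/= in Ax.
    rewrite -(vol_translate (L *m col_of_tuple x) mB); congr vol.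
    by apply/funext => y; apply/propext; split => [|[]].
  rewrite -(@vol_set0 R n); congr vol.
  by apply/funext => y; apply/propext; split => // -[Ay _];
    case/negP: Ax; rewrite inE.
rewrite (vol_fubini (E := fun x y => A (L *m x) /\ B (y + L *m x))); last first.
  apply: measurableI.
    exact: (measurable_preimage_col (f := fun p => L *m col_of_tuple p.1)).
  apply: (measurable_preimage_col
    (f := fun p => col_of_tuple p.2 + L *m col_of_tuple p.1)) => // i.
  exact: measurable_add_col.
transitivity (\int[lebesgue_measure_tuple R n]_y
   vol [set x | A (L *m x - col_of_tuple y)%R /\ B (L *m x)])%E.
  apply: eq_integral => y _.
  rewrite -(vol_translate (- (M *m col_of_tuple y))
    (A := [set x | A (L *m x) /\ _])); last first.
    apply: colmeasurableI; first exact: mL.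
    exact: (@colmeasurable_affine _ _ L (col_of_tuple y)).
  congr vol; apply/funext => x /=.
  rewrite mulmxDr mulmxN mulmxA LM mul1mx; congr (_ /\ B _).
  by rewrite addrC subrK.
rewrite -(vol_fubini (E := fun x y => A (L *m x - y) /\ B (L *m x))); last first.
  apply: measurableI; last first.
    exact: (measurable_preimage_col (f := fun p => L *m col_of_tuple p.1)).
  apply: (measurable_preimage_col
    (f := fun p => L *m col_of_tuple p.1 - col_of_tuple p.2)) => // i.
  apply: measurable_add_col => // {}i.
  rewrite (_ : (fun _ => _) = (fun p => - (col_of_tuple p.2 i 0))).
    exact: measurable_funN (ms i).
  by apply/funext => p; rewrite mxE.
rewrite -integral_if_vol//; last exact: mL.
apply: eq_integral => x _; case: ifPn => Bx; first rewrite inE/= in Bx.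
  rewrite N0 -(vol_translate (- (L *m col_of_tuple x)) (mN 0)); congr vol.
  apply/funext => y /=; apply/propext.
  by rewrite sub0r opprD opprK addrC; split => [[]|].
rewrite -(@vol_set0 R n); congr vol.
by apply/funext => y; apply/propext; split => // -[_ By];
  case/negP: Bx; rewrite inE.
Qed.

(** The case [L = M = 1] of [vol_linear_neg], with [B] the unit cube, of volume 1. *)
Lemma vol_opp n (A : set 'cV[R]_n) : colmeasurable A ->
  vol [set x | A (- x)] = vol A.
Proof.
move=> mA.
have := vol_linear_neg (mul1mx 1%:M) mA (@colmeasurable_cube n 1).
under eq_set do rewrite mul1mx.
under [X in (_ = vol X * _)%E -> _]eq_set do rewrite mul1mx.
by rewrite vol_cube// expr1n mule1 mul1e => ->.
Qed.

(** The factor by which [L] changes volumes is the same for [A] and [B]. Cross-multiplying avoids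
    naming it, so no determinant occurs; it is found by testing on one well-chosen [B]. *)
Lemma vol_linear n (L M : 'M[R]_n) A B : L *m M = 1%:M ->
  colmeasurable A -> colmeasurable B ->
  (vol [set x | A (L *m x)] * vol B = vol [set x | B (L *m x)] * vol A)%E.
Proof. by move=> LM mA mB; rewrite (vol_linear_neg LM mA mB) vol_opp. Qed.

(** The test set in [vol_linear] is the cube of side [c], whose preimage is the unit cube. *)
Lemma vol_scale n (c : R) (A : set 'cV[R]_n) : 0 < c -> colmeasurable A ->
  ((c ^+ n)%:E * vol [set x | A (c *: x)] = vol A)%E.
Proof.
move=> c0 mA.
have := @vol_linear n c%:M (c^-1)%:M _ (cube n c) _ mA (@colmeasurable_cube n c).
rewrite -scalar_mxM divff ?gt_eqF// => /(_ erefl).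
under eq_set do rewrite mul_scalar_mx.
rewrite (_ : [set x | cube n c (c%:M *m x)] = cube n 1).
  by rewrite !vol_cube ?ltW// expr1n mul1e muleC.
apply/funext => x; apply/propext; rewrite /cube/= mul_scalar_mx.
split => H i; have := H i; rewrite !in_itv/= !mxE.
  by rewrite pmulr_rge0// ger_pMr.
by rewrite pmulr_rge0// ger_pMr.
Qed.

End volume_invariance.

Arguments cube {R} n c _.

(** * Slices orthogonal to a unit vector *)

Section orthogonal_slices.
Variable R : realType.
Local Notation T := (measurableTypeR R).

Lemma dotE n (x y : 'cV[R]_n) : dot x y = (x^T *m y) 0 0.
Proof. by rewrite mxE; apply: eq_bigr => i _; rewrite mxE. Qed.

Lemma dotC n (x y : 'cV[R]_n) : dot x y = dot y x.
Proof. by apply: eq_bigr => i _; rewrite mulrC. Qed.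

Lemma dotDr n (x y z : 'cV[R]_n) : dot x (y + z) = dot x y + dot x z.
Proof. by rewrite !dotE mulmxDr mxE. Qed.

Lemma dotZr n a (x y : 'cV[R]_n) : dot x (a *: y) = a * dot x y.
Proof. by rewrite !dotE -scalemxAr mxE. Qed.

Lemma dotNr n (x y : 'cV[R]_n) : dot x (- y) = - dot x y.
Proof. by rewrite !dotE mulmxN mxE. Qed.

Lemma dotDl n (x y z : 'cV[R]_n) : dot (x + y) z = dot x z + dot y z.
Proof. by rewrite dotC dotDr !(dotC z). Qed.

Lemma dotZl n a (x y : 'cV[R]_n) : dot (a *: x) y = a * dot x y.
Proof. by rewrite dotC dotZr (dotC y). Qed.

Lemma dotNl n (x y : 'cV[R]_n) : dot (- x) y = - dot x y.
Proof. by rewrite dotC dotNr (dotC y). Qed.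

Lemma dot0l n (x : 'cV[R]_n) : dot 0 x = 0.
Proof. by rewrite -(scale0r 0) dotZl mul0r. Qed.

Lemma dot_suml n (I : finType) (F : I -> 'cV[R]_n) y :
  dot (\sum_i F i) y = \sum_i dot (F i) y.
Proof.
rewrite (big_morph (fun x => dot x y) (id1 := 0) (op1 := +%R))//.
- by move=> a b; exact: dotDl.
- exact: dot0l.
Qed.

Lemma dot_mulmx n k (M : 'M[R]_(n, k)) x y : dot x (M *m y) = dot (M^T *m x) y.
Proof. by rewrite !dotE trmx_mul trmxK mulmxA. Qed.

Lemma dotxx_ge0 n (x : 'cV[R]_n) : 0 <= dot x x.
Proof. by apply: sumr_ge0 => i _; rewrite -expr2 sqr_ge0. Qed.

Lemma sqr_coord_le_dot n (x : 'cV[R]_n) i : x i 0 ^+ 2 <= dot x x.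
Proof.
rewrite /dot (bigD1 i)//= -expr2 lerDl.
by apply: sumr_ge0 => j _; rewrite -expr2 sqr_ge0.
Qed.

Lemma dotxx_eq0 n (x : 'cV[R]_n) : (dot x x == 0) = (x == 0).
Proof.
apply/eqP/eqP => [x0|->]; last by rewrite dot0l.
apply/colP => i; rewrite mxE; apply/eqP; rewrite -sqrf_eq0 eq_le sqr_ge0 andbT.
by rewrite -x0 sqr_coord_le_dot.
Qed.

Lemma dotxx_gt0 n (x : 'cV[R]_n) : (0 < dot x x) = (x != 0).
Proof. by rewrite lt_neqAle eq_sym dotxx_eq0 dotxx_ge0 andbT. Qed.

(** The parameter [r] is the square of the radius. *)
Definition sqball n (r : R) : set 'cV[R]_n := [set x | dot x x <= r].
Arguments sqball : clear implicits.

Lemma colmeasurable_sqball n r : colmeasurable (sqball n r).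
Proof.
have := colmeasurable_preimage (f := fun x : 'cV[R]_n => dot x x) _
  (measurable_itv `]-oo, r]).
rewrite (_ : _ @^-1` _ = sqball n r); last first.
  by apply/funext => x; rewrite /sqball/= in_itv.
apply; apply: measurable_sum => i; apply: measurable_funM;
  exact: measurable_col_of_tuple.
Qed.

(** A ball of radius [r] lies in a cube of side [2 * r], translated so as to be centred at the
    origin. *)
Lemma vol_sqball_bounded n (A : set 'cV[R]_n) (r : R) : 0 <= r ->
  colmeasurable A -> A `<=` sqball n (r ^+ 2) ->
  (vol A <= ((2 * r) ^+ n)%:E)%E.
Proof.
move=> r0 mA Ar; rewrite -vol_cube ?mulr_ge0//.
rewrite -(vol_translate (const_mx r) (@colmeasurable_cube _ _ _)).
apply: le_vol => //.
  have := colmeasurable_affine 1%:M (const_mx r) (@colmeasurable_cube R n (2 * r)).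
  by under eq_set do rewrite mul1mx addrC.
move=> x Ax i; rewrite in_itv/= !mxE.
have : `|x i 0| <= r.
  rewrite -ler_sqr ?nnegrE// real_normK ?num_real//.
  exact: le_trans (sqr_coord_le_dot x i) (Ar _ Ax).
by rewrite ler_norml => /andP[? ?]; apply/andP; split; lra.
Qed.

(** The test set in [vol_linear] is the unit ball: [O] preserves it, and its volume is finite and
    positive, hence can be cancelled. *)
Lemma vol_orthogonal n (O : 'M[R]_n) A : O^T *m O = 1%:M -> colmeasurable A ->
  vol [set x | A (O *m x)] = vol A.
Proof.
move=> OO mA.
have := vol_linear (mulmx1C OO) mA (@colmeasurable_sqball n 1).
rewrite (_ : [set x | sqball n 1 (O *m x)] = sqball n 1); last first.
  by apply/funext => x; rewrite /sqball/= dot_mulmx mulmxA OO mul1mx.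
have Bfin : vol (sqball n 1) \is a fin_num.
  rewrite ge0_fin_numE ?vol_ge0//.
  apply: le_lt_trans (vol_sqball_bounded ler01 _ _) (ltry _).
    exact: colmeasurable_sqball.
  by rewrite expr1n.
have B0 : (0 < vol (sqball n 1))%E.
  (* Coordinates in [[0, 1/(n+1)]] have a sum of squares at most [n/(n+1)]. Taking [n+1] keeps the
     side positive in dimension 0. *)
  have : (0 < vol (cube n (n.+1%:R^-1 : R)))%E.
    by rewrite vol_cube// lte_fin exprn_gt0.
  move=> /lt_le_trans; apply; apply: le_vol.
  - exact: colmeasurable_cube.
  - exact: colmeasurable_sqball.
  move=> x xc; rewrite /sqball/=.
  apply: (@le_trans _ _ (\sum_(i < n) n.+1%:R^-1)).
    apply: ler_sum => i _; have := xc i; rewrite in_itv/= => /andP[x0 x1].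
    rewrite -[leRHS]mulr1; apply: ler_pM => //.
    by rewrite (le_trans x1)// invf_le1// ler1n.
  rewrite sumr_const card_ord -[_ *+ _]mulr_natl ler_pdivrMr// mul1r ler_nat.
  exact: leqnSn.
rewrite muleC => H; apply/eqP; rewrite eq_le.
by rewrite -(lee_pmul2l Bfin B0) -[X in _ && X](lee_pmul2l Bfin B0) H lexx.
Qed.

(* Householder reflection exchanging u and the first basis vector *)
Lemma orthogonal_first_col n (u : 'cV[R]_n.+1) : dot u u = 1 ->
  exists H : 'M[R]_n.+1, H^T *m H = 1%:M /\ col 0 H = u.
Proof.
move=> u1; pose e : 'cV[R]_n.+1 := delta_mx 0 0.
have [w wE] : exists w, w = u - e by exists (u - e).
have ee : dot e e = 1.
  rewrite /dot (bigD1 0)//= big1 ?addr0 => [|i i0]; rewrite !mxE ?mulr1//.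
  by rewrite (negPf i0) mul0r.
have colE (H : 'M[R]_n.+1) : col 0 H = H *m e by rewrite colE.
(* For [u = e] there is nothing to reflect, and the formula for [H] would divide by zero. *)
have [w0|w0] := eqVneq w 0.
  exists 1%:M; rewrite trmx1 mulmx1 colE mul1mx; split => //.
  by apply/esym/eqP; rewrite -subr_eq0 -wE w0.
have ww : dot w w = 2 - 2 * dot u e.
  rewrite wE !(dotDl, dotDr, dotNl, dotNr) u1 ee (dotC e u); ring.
have ww0 : dot w w != 0 by rewrite dotxx_eq0.
have we : dot w e = - (dot w w / 2).
  by rewrite ww wE dotDl dotNl ee; field.
have outer (x : 'cV[R]_n.+1) : w *m w^T *m x = dot w x *: w.
  by rewrite -mulmxA [w^T *m x]mx11_scalar -dotE mul_mx_scalar.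
pose H := 1%:M - (2 / dot w w) *: (w *m w^T).
have HT : H^T = H by rewrite /H linearB/= linearZ/= trmx_mul trmxK trmx1.
exists H; split.
  pose P := w *m w^T; have PP : P *m P = dot w w *: P.
    by rewrite [LHS]mulmxA outer -scalemxAl.
  rewrite HT /H -/P mulmxBr mulmx1 mulmxBl mul1mx -scalemxAr -scalemxAl PP.
  move: P {PP H HT outer} => P; apply/matrixP => i j; rewrite !mxE; field.
  exact: ww0.
rewrite colE mulmxBl mul1mx -scalemxAl outer we scalerA.
rewrite (_ : _ * _ = -1); last by field.
by rewrite scaleN1r opprK wE addrC subrK.
Qed.

(** Shows that the choice made by [xget] is not the default 0: deleting the first column of an
    orthogonal matrix that begins with [u] gives a frame. *)
Lemma hyperplane_frameP n (u : 'cV[R]_n.+1) : dot u u = 1 ->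
  (hyperplane_frame u)^T *m hyperplane_frame u = 1%:M /\
  (hyperplane_frame u)^T *m u = 0.
Proof.
move=> /orthogonal_first_col[H [HH H0]].
apply: (xgetPex 0 (P := [set Q : 'M[R]_(n.+1, n) | Q^T *m Q = 1%:M /\ Q^T *m u = 0])).
have HHE i j : \sum_k H k i * H k j = (i == j)%:R.
  have := congr1 (fun M : 'M[R]_n.+1 => M i j) HH; rewrite !mxE => <-.
  by apply: eq_bigr => k _; rewrite mxE.
exists (\matrix_(i, j) H i (lift 0 j)); split.
  apply/matrixP => i j; rewrite !mxE; under eq_bigr do rewrite !mxE.
  by rewrite HHE (inj_eq lift_inj).
apply/matrixP => i j; rewrite !mxE -H0; under eq_bigr do rewrite !mxE.
by rewrite HHE eq_sym (negPf (neq_lift _ _)).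
Qed.

Lemma integral_cst_itv (a b : R) (C : \bar R) : a <= b ->
  (\int[lebesgue_measure]_(s in `[a, b]) cst C (s : T) = C * (b - a)%:E)%E.
Proof.
move=> ab; rewrite (@integral_cst _ T)//; congr (_ * _)%E.
rewrite [LHS](lebesgue_measure_itv `[a, b])/= lte_fin.
by case: ltgtP ab => // -> _; rewrite subrr.
Qed.

(** * Orthogonal coordinates along a unit normal *)

Section frame.
Context n (u : 'cV[R]_n.+1) (u1 : dot u u = 1).
Let Q : 'M[R]_(n.+1, n) := hyperplane_frame u.
Let QQ : Q^T *m Q = 1%:M. Proof. exact: (hyperplane_frameP u1).1. Qed.
Let Qu : Q^T *m u = 0. Proof. exact: (hyperplane_frameP u1).2. Qed.

Lemma frame_dot s y z : dot z (s *: u + Q *m y) = s * dot z u + dot (Q^T *m z) y.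
Proof. by rewrite dotDr dotZr dot_mulmx. Qed.

Lemma frame_normal s y : dot u (s *: u + Q *m y) = s.
Proof. by rewrite frame_dot u1 mulr1 Qu dot0l addr0. Qed.

Lemma frame_norm s y :
  dot (s *: u + Q *m y) (s *: u + Q *m y) = s ^+ 2 + dot y y.
Proof.
rewrite frame_dot dotC frame_normal -expr2; congr (_ + dot _ _).
by rewrite mulmxDr -scalemxAr Qu scaler0 add0r mulmxA QQ mul1mx.
Qed.

Let F : 'M[R]_n.+1 := row_mx u Q.

Let FF : F^T *m F = 1%:M.
Proof.
rewrite [F^T](@tr_row_mx _ n.+1 1 n) [LHS](@mul_col_row _ 1 n n.+1 1 n).
rewrite QQ Qu (_ : u^T *m Q = 0); last first.
  by apply: trmx_inj; rewrite trmx_mul trmxK Qu trmx0.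
rewrite [u^T *m u]mx11_scalar -dotE u1; by rewrite [RHS](@scalar_mx_block _ 1 n).
Qed.

Let FE s y : F *m (col_mx s%:M y : 'cV_(1 + n)) = s *: u + Q *m y.
Proof. by rewrite [LHS](@mul_row_col _ n.+1 1 n) mul_mx_scalar. Qed.

(** Since [F] is orthogonal, [z = F F^T z], and under the hypothesis only the first entry of [F^T z]
    survives. *)
Lemma kernel_frame (z : 'cV[R]_n.+1) : Q^T *m z = 0 -> z = dot u z *: u.
Proof.
move=> Qz.
have E : F^T *m z = col_mx (dot u z)%:M 0 :> 'cV_(1 + n).
  rewrite [F^T](@tr_row_mx _ n.+1 1 n) [LHS](@mul_col_mx _ 1 n n.+1 1) Qz.
  by rewrite [u^T *m z]mx11_scalar -dotE.
by rewrite -[LHS]mul1mx -(mulmx1C FF) -mulmxA E FE mulmx0 addr0.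
Qed.

(** The rotation [F] turns slices at constant first coordinate into slices orthogonal to [u], and it
    preserves volume. *)
Lemma vol_hyperplane_slices A : colmeasurable A ->
  vol A = (\int[lebesgue_measure]_(s in [set: T]) hyperplane_vol u s A)%E.
Proof.
move=> mA; rewrite -(vol_orthogonal FF mA) vol_succ.
by apply: eq_integral => s _; congr vol; apply/funext => y /=; rewrite FE.
Qed.

Lemma measurable_hyperplane_vol A : colmeasurable A ->
  measurable_fun [set: T] (fun s : T => hyperplane_vol u s A).
Proof.
move=> mA; have mOA : colmeasurable [set x | A (0 + F *m x)].
  exact: colmeasurable_affine.
apply: eq_measurable_fun (measurable_vol_slice mOA) => s _.
by congr vol; apply/funext => y /=; rewrite add0r FE.
Qed.

Lemma colmeasurable_hyperplane s A : colmeasurable A ->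
  colmeasurable [set y | A (s *: u + hyperplane_frame u *m y)].
Proof. exact: colmeasurable_affine. Qed.

Lemma vol_slices_itv (a b : R) A : colmeasurable A ->
  (forall x, A x -> dot u x \in `[a, b]) ->
  vol A = (\int[lebesgue_measure]_(s in `[a, b]) hyperplane_vol u (s : T) A)%E.
Proof.
move=> mA Aab; rewrite vol_hyperplane_slices// [RHS]integral_mkcond.
apply: eq_integral => s _; rewrite patchE mem_setE; case: ifPn => // sab.
rewrite -[RHS](@vol_set0 R n); congr vol; apply/funext => y; apply/propext.
by split=> // /Aab; rewrite frame_normal (negPf sab).
Qed.

Lemma hyperplane_vol_ge0 s A : (0 <= hyperplane_vol u s A)%E.
Proof. exact: vol_ge0. Qed.

Lemma vol_slices_const (a b : R) C A : a <= b -> colmeasurable A ->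
  (forall x, A x -> dot u x \in `[a, b]) ->
  (forall s, s \in `[a, b] -> hyperplane_vol u s A = C) ->
  (vol A = C * (b - a)%:E)%E.
Proof.
move=> ab mA Aab hC; rewrite (vol_slices_itv mA Aab) -integral_cst_itv//.
by apply: eq_integral => s; rewrite mem_setE => /hC.
Qed.

Lemma vol_slices_le (a b : R) (f : T -> \bar R) A : colmeasurable A ->
  (forall x, A x -> dot u x \in `[a, b]) -> measurable_fun [set: T] f ->
  (forall s, s \in `[a, b] -> (hyperplane_vol u s A <= f s)%E) ->
  (vol A <= \int[lebesgue_measure]_(s in `[a, b]) f s)%E.
Proof.
move=> mA Aab mf hf; rewrite (vol_slices_itv mA Aab).
apply: ge0_le_integral => //.
- by apply: measurable_funTS; exact: measurable_hyperplane_vol.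
- exact: measurable_funTS.
Qed.

End frame.

End orthogonal_slices.

Arguments sqball {R} n r _.

(** * Volume of thin slabs *)

Section slabs.
Variable R : realType.
Local Notation T := (measurableTypeR R).

Lemma integral_linear (c t : R) : 0 <= t ->
  (\int[lebesgue_measure]_(s in `[0%R, t]) (c * (s : T))%:E =
   (c * t ^+ 2 / 2)%:E)%E.
Proof.
rewrite le_eqVlt => /predU1P[<-|t0].
  by rewrite set_itv1 expr0n/= mulr0 mul0r integral_set1.
have dF (x : R) : is_derive x 1 (fun y : R => c * y ^+ 2 / 2) (c * x).
  by apply: is_derive_eq; rewrite /GRing.scale/=; field.
have cF (x : R) : {for x, continuous (fun y : R => c * y ^+ 2 / 2)}.
  by apply/differentiable_continuous/derivable1_diffP.
rewrite (continuous_FTC2 (F := fun y : R => c * y ^+ 2 / 2))//.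
- by rewrite -EFinB expr0n/= mulr0 mul0r subr0.
- apply: continuous_subspaceT => x; exact: mulrl_continuous.
- split.
  + by move=> x _; exact: ex_derive.
  + exact/cvg_at_right_filter/cF.
  + exact/cvg_at_left_filter/cF.
- by move=> x _; rewrite derive1E derive_val.
Qed.

(** Each slice orthogonal to [w] lies in a ball of radius [r], so it has volume at most
    [(2 * r) ^ n], and the slab has thickness [2 * eps / |w|]. What matters is that [K] depends
    neither on [A] nor on [eps]. *)
Lemma vol_slab_bounded n (w : 'cV[R]_n) (r : R) : w != 0 -> 0 <= r ->
  exists K : R, forall A (eps : R), colmeasurable A -> 0 <= eps ->
    A `<=` sqball n (r ^+ 2) -> (forall x, A x -> `|dot w x| <= eps) ->
    (vol A <= (K * eps)%:E)%E.
Proof.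
case: n w => [|n] w w0 r0; first by rewrite flatmx0 eqxx in w0.
have ww0 : 0 < dot w w by rewrite dotxx_gt0.
pose k := Num.sqrt (dot w w); have k0 : 0 < k by rewrite sqrtr_gt0.
pose u := k^-1 *: w.
have u1 : dot u u = 1.
  by rewrite dotZl dotZr -[dot w w]sqr_sqrtr ?ltW// -/k; field; rewrite gt_eqF.
exists ((2 * r) ^+ n * 2 / k) => A eps mA eps0 Ar Aw.
have -> : (2 * r) ^+ n * 2 / k * eps = (2 * r) ^+ n * (eps / k - - (eps / k)).
  by field; rewrite gt_eqF.
have Au x : A x -> dot u x \in `[- (eps / k), eps / k].
  move=> /Aw; rewrite ler_norml dotZl in_itv/= => /andP[w1 w2].
  by rewrite -mulNr !(mulrC _ k^-1) !ler_pM2l ?invr_gt0// w1.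
have ab : - (eps / k) <= eps / k by rewrite ge0_cp// divr_ge0// ltW.
rewrite EFinM -integral_cst_itv//; apply: (vol_slices_le u1) => // s _.
apply: vol_sqball_bounded => //; first exact: colmeasurable_hyperplane.
move=> y /Ar; rewrite /sqball/= frame_norm//; apply: le_trans.
by rewrite lerDr sqr_ge0.
Qed.

End slabs.

(** * Polytopes *)

Section polytopes.
Variable R : realType.
Local Notation T := (measurableTypeR R).

Lemma colmeasurable_polytope n m (U : 'M[R]_(n, m)) b :
  colmeasurable (polytope U b).
Proof. by apply: colmeasurable_forall => i; exact: colmeasurable_dot_le. Qed.

Lemma colmeasurable_facet n m (U : 'M[R]_(n, m)) b i :
  colmeasurable (facet U b i).
Proof.
apply: colmeasurableI; first exact: colmeasurable_polytope.
rewrite (_ : [set x | _] = [set x | dot (col i U) x <= b i 0] `&`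
    [set x | dot (- col i U) x <= - b i 0]).
  by apply: colmeasurableI; exact: colmeasurable_dot_le.
apply/funext => x; apply/propext => /=; rewrite dotNl lerN2.
by split=> [->|[? ?]]; [split|apply/eqP; rewrite eq_le; apply/andP].
Qed.

(** The inverse of one plus the sum of all inverses is a bound that stays positive even when [I] is
    empty. *)
Lemma finite_positive_lower_bound (I : finType) (f : I -> R) :
  (forall i, 0 < f i) -> exists2 d, 0 < d & forall i, d <= f i.
Proof.
move=> f0; have S0 : 0 < 1 + \sum_i (f i)^-1.
  by rewrite ltr_pwDl// sumr_ge0// => i _; rewrite invr_ge0 ltW.
exists (1 + \sum_i (f i)^-1)^-1; first by rewrite invr_gt0.
move=> i; rewrite -[leRHS]invrK lef_pV2 ?posrE ?invr_gt0//.
rewrite (bigD1 i)//= addrCA lerDl addr_ge0// sumr_ge0// => j _.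
by rewrite invr_ge0 ltW.
Qed.

(** All constraints have a common positive slack [d] at [x], so a small cube with corner [x] fits
    inside. *)
Lemma vol_polytope_gt0 n m (U : 'M[R]_(n, m)) (b : 'cV[R]_m) x :
  (forall j, dot (col j U) x < b j 0) -> (0 < vol (polytope U b))%E.
Proof.
move=> xb; have [|d d0 dle] := @finite_positive_lower_bound _
  (fun j => b j 0 - dot (col j U) x).
  by move=> j; rewrite subr_gt0.
(* [L] exceeds the sum of absolute entries of each column, so moving by a vector with entries in
   [[0, d / L]] raises no [dot (col j U)] by more than [d]. *)
pose L := 1 + \sum_j \sum_k `|U k j|.
have L0 : 0 < L by rewrite ltr_pwDl// !sumr_ge0// => j _; rewrite sumr_ge0.
have c0 : 0 < d / L by rewrite divr_gt0.
have : (0 < vol (cube n (d / L)))%E by rewrite vol_cube ?ltW// lte_fin exprn_gt0.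
move=> /lt_le_trans; apply.
rewrite -(vol_translate x (@colmeasurable_polytope _ _ U b)).
apply: le_vol; first exact: colmeasurable_cube.
  have := colmeasurable_affine 1%:M x (@colmeasurable_polytope _ _ U b).
  by under eq_set do rewrite mul1mx addrC.
move=> y yc j; rewrite dotDr -lerBrDr; apply: le_trans (dle j).
apply: (@le_trans _ _ (\sum_k `|U k j| * (d / L))).
  apply: ler_sum => k _; have := yc k; rewrite in_itv/= mxE => /andP[y0 y1].
  apply: (le_trans (ler_norm _)); rewrite normrM ler_wpM2l//.
  by rewrite ger0_norm.
rewrite -mulr_suml mulrCA ger_pMr// ler_pdivrMr// mul1r.
rewrite /L (bigD1 j)//= addrCA lerDl addr_ge0// sumr_ge0// => k _.
by rewrite sumr_ge0.
Qed.

(** Each signed basis vector is a non-negative combination of the columns, so for [b <= 1] the sum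
    of its coefficients bounds that coordinate. The radius is therefore uniform in [b]. *)
Lemma polytope_bounded n m (U : 'M[R]_(n, m)) : pos_hull U = setT ->
  exists2 r, 0 <= r & forall b : 'cV[R]_m, (forall j, b j 0 <= 1) ->
    polytope U b `<=` sqball n (r ^+ 2).
Proof.
move=> UT.
have dot_bounded z : exists C, forall b : 'cV[R]_m, (forall j, b j 0 <= 1) ->
    forall x, polytope U b x -> dot z x <= C.
  have [c [c0 ->]] : pos_hull U z by rewrite UT.
  exists (\sum_j c j) => b b1 x Px; rewrite dot_suml; apply: ler_sum => j _.
  by rewrite dotZl ler_piMr// (le_trans (Px j)).
have coord (x : 'cV[R]_n) k : dot (delta_mx k 0) x = x k 0.
  rewrite /dot (bigD1 k)//= big1 ?addr0 => [|i ik]; rewrite mxE ?eqxx ?mul1r//.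
  by rewrite (negPf ik) mul0r.
have /choice[C CP] : forall k, exists C, forall b : 'cV[R]_m, (forall j, b j 0 <= 1) ->
    forall x, polytope U b x -> `|x k 0| <= C.
  move=> k; have [C1 H1] := dot_bounded (delta_mx k 0).
  have [C2 H2] := dot_bounded (- delta_mx k 0).
  exists (Num.max C1 C2) => b b1 x Px; rewrite ler_norml.
  have := H1 b b1 x Px; have := H2 b b1 x Px; rewrite dotNl coord => h2 h1.
  by rewrite lerNl !le_max h1 h2 orbT.
have S0 : 0 <= \sum_k C k ^+ 2 by rewrite sumr_ge0// => k _; rewrite sqr_ge0.
(* With [S] the sum of the squared bounds, [(1 + S) ^ 2 >= S], which spares a square root. *)
exists (1 + \sum_k C k ^+ 2); first by rewrite addr_ge0.
move=> b b1 x Px; rewrite /sqball/=.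
apply: (@le_trans _ _ (\sum_k C k ^+ 2)); last by nra.
apply: ler_sum => k _; rewrite -expr2 -real_normK ?num_real//.
have := CP k b b1 x Px => h; rewrite ler_sqr ?nnegrE//.
exact: le_trans h.
Qed.

Lemma enorm_eq1 n (x : 'cV[R]_n) : enorm x = 1 -> dot x x = 1.
Proof.
by move=> x1; rewrite -[LHS]sqr_sqrtr ?dotxx_ge0// -/(enorm x) x1 expr1n.
Qed.

(** The slicing argument by contradiction. The point [x0] stands in for linear independence of the
    [u_j] with [c j > 0]: it says that they lie in an open half-space, which makes the polytopes
    below have interior points. *)
Lemma positive_circuit_parallel n m (U : 'M[R]_(n.+1, m)) :
  (forall j, dot (col j U) (col j U) = 1) -> pos_hull U = setT ->
  (forall (b : 'cV[R]_m) i, (forall j, 0 <= b j 0 <= 1) ->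
    (0 < vol (polytope U b))%E ->
    ((b i 0)%:E * hyperplane_vol (col i U) (b i 0)%R (facet U b i) <=
     vol (polytope U b))%E) ->
  forall i (c : 'I_m -> R) x0, (forall j, 0 <= c j) ->
    \sum_j c j *: col j U = - col i U ->
    (forall j, 0 < c j -> dot (col j U) x0 < 0) ->
  forall j, 0 < c j -> col j U = col i U \/ col j U = - col i U.
Proof.
move=> U1 /polytope_bounded[r r0 Ur] H i c x0 c0 cE x0P j cj.
set u := col i U in cE *; have u1 : dot u u = 1 := U1 i.
have dotu x : - dot u x = \sum_k c k * dot (col k U) x.
  by rewrite -dotNl -cE dot_suml; apply: eq_bigr => k _; rewrite dotZl.
(* Otherwise [dot u x0 < 0], whereas [dotu] writes [- dot u x0] as a sum of nonpositive terms. *)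
have ci : c i = 0.
  apply/eqP; rewrite eq_le c0 andbT leNgt; apply/negP => ci.
  have := dotu x0; have := x0P _ ci; rewrite -/u => ux0 ux0E.
  have : 0 < - dot u x0 by rewrite oppr_gt0.
  rewrite ux0E ltNge => /negP; apply; apply: sumr_le0 => k _.
  have := c0 k; rewrite le_eqVlt => /predU1P[<-|ck]; first by rewrite mul0r.
  by rewrite pmulr_rle0// ltW// x0P.
have ji : j != i by apply: contraTneq cj => ->; rewrite ci ltxx.
(* The component of [u_j] orthogonal to [u], in frame coordinates; it vanishes exactly when [u_j] is
   parallel to [u]. *)
pose w := (hyperplane_frame u)^T *m col j U.
have [w0|w0] := eqVneq w 0.
  have jE := kernel_frame u1 w0; have := U1 j; rewrite jE dotZl dotZr u1 mulr1.
  move/eqP; rewrite -expr2 sqrf_eq1 => /orP[]/eqP ->.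
    by left; rewrite scale1r.
  by right; rewrite scaleN1r.
exfalso.
pose b t : 'cV[R]_m := \col_k if k == i then t else if 0 < c k then 0 else 1.
have b01 t : 0 <= t <= 1 -> forall k, 0 <= b t k 0 <= 1.
  by move=> t01 k; rewrite mxE; case: ifP => // _; case: ifP; rewrite lexx ler01.
have bi t : b t i 0 = t by rewrite mxE eqxx.
pose P t := polytope U (b t).
have mP t : colmeasurable (P t) by exact: colmeasurable_polytope.
(* A small positive multiple of [x0] satisfies all constraints strictly; [S] is large enough for the
   bounds [t] and 1. *)
have P_gt0 t : 0 < t <= 1 -> (0 < vol (P t))%E.
  move=> /andP[t0 t1].
  pose S := 1 + \sum_k `|dot (col k U) x0|.
  have S0 : 0 < S by rewrite ltr_pwDl// sumr_ge0.
  apply: (@vol_polytope_gt0 _ _ _ _ ((t / S) *: x0)) => k; rewrite dotZr mxE.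
  have kt : t / S * dot (col k U) x0 < t.
    rewrite -mulrA gtr_pMr// mulrC ltr_pdivrMr// mul1r.
    apply: (le_lt_trans (ler_norm _)); rewrite /S (bigD1 k)//= addrCA.
    by rewrite ltrDl ltr_pwDl// sumr_ge0.
  case: ifPn => // _; case: ifPn => ck; last exact: lt_le_trans t1.
  by rewrite pmulr_rlt0 ?x0P// divr_gt0.
have Pneg t x k : P t x -> c k * dot (col k U) x <= 0.
  move=> /(_ k); have := c0 k; rewrite le_eqVlt => /predU1P[<-|ck].
    by rewrite mul0r.
  rewrite mxE (negPf (_ : k != i)) ?ck => [? |]; first by rewrite pmulr_rle0.
  by apply: contraTneq ck => ->; rewrite ci ltxx.
have Pu t x : P t x -> dot u x \in `[0, t].
  move=> Px; rewrite in_itv/=; apply/andP; split; last by rewrite -(bi t); exact: Px.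
  by rewrite -oppr_le0 dotu; apply: sumr_le0 => k _; exact: Pneg Px.
(* All terms of [dotu] are nonpositive on [P t], so the single term of index [j] is at most
   [dot u x] in absolute value. *)
have Pj t x : P t x -> `|dot (col j U) x| <= dot u x / c j.
  move=> Px; have := Px j; rewrite mxE (negPf ji) cj => jx0.
  rewrite ler0_norm// ler_pdivlMr// mulNr lerNl dotu (bigD1 j)//= mulrC gerDl.
  by apply: sumr_le0 => k _; exact: Pneg Px.
pose G t := hyperplane_vol u t (facet U (b t) i).
(* Only constraint [i] depends on [t], so the slice at height [s] is the same for every [t >= s]. *)
have GE s t : s <= t -> hyperplane_vol u s (P t) = G s.
  move=> st; congr vol; apply/funext => y; apply/propext => /=.
  rewrite /facet/= frame_normal// bi; split=> [Py|[Py _] k].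
    split=> // k; have := Py k; rewrite !mxE; case: eqP => // -> _.
    by rewrite frame_normal.
  by apply: le_trans (Py k) _; rewrite !mxE; case: eqP.
have mG t : colmeasurable
    [set y | facet U (b t) i (t *: u + hyperplane_frame u *m y)].
  by apply: colmeasurable_hyperplane; exact: colmeasurable_facet.
have [K KP] := vol_slab_bounded w0 r0.
pose C := K * ((c j)^-1 + `|dot (col j U) u|).
(* By [Pj], the slice at height [s] lies in a slab orthogonal to [w] of width proportional to
   [s]. *)
have C0 s : 0 <= s <= 1 -> (G s <= (C * s)%:E)%E.
  move=> s01; have /andP[s0 s1] := s01; rewrite /C -mulrA; apply: KP => //.
  - by rewrite mulr_ge0// addr_ge0// invr_ge0.
  - have bs1 k : b s k 0 <= 1 by have /andP[] := b01 s s01 k.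
    move=> y [Py _]; have := Ur _ bs1 _ Py; rewrite /sqball/= frame_norm//.
    by apply: le_trans; rewrite lerDr sqr_ge0.
  - move=> y [Py _]; have := Pj _ _ Py; rewrite frame_normal// frame_dot// -/w.
    move=> sw; rewrite (_ : dot w y = (s * dot (col j U) u + dot w y) +
      - (s * dot (col j U) u)); last by rewrite addrAC subrr add0r.
    apply: (le_trans (ler_normD _ _)); rewrite mulrDl lerD//; first by rewrite [leRHS]mulrC.
    by rewrite normrN normrM mulrC (ger0_norm s0).
have V_le k t : 0 <= t <= 1 ->
    (forall s, 0 <= s <= 1 -> (G s <= (C / 2 ^+ k * s)%:E)%E) ->
    (vol (P t) <= (C / 2 ^+ k * t ^+ 2 / 2)%:E)%E.
  move=> /andP[t0 t1] Gk; rewrite -integral_linear//.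
  have mlin : measurable_fun [set: T] (EFin \o (fun s : T => C / 2 ^+ k * s)).
    by apply/measurable_EFinP; exact: measurable_funM.
  apply: (vol_slices_le u1 (mP t) (@Pu t) mlin).
  move=> s; rewrite in_itv/= => /andP[s0 st]; rewrite GE//; apply: Gk.
  by rewrite s0 (le_trans st).
(* Each round halves the constant: [s * G s <= vol (P s) <= C / 2 ^ k * s ^ 2 / 2], then divide by
   [s]. At [s = 0], [C0] already gives the bound 0. *)
have G_le k s : 0 <= s <= 1 -> (G s <= (C / 2 ^+ k * s)%:E)%E.
  elim: k s => [|k IH] s s01; first by rewrite expr0 divr1 C0.
  have /andP[s0 s1] := s01.
  move: s0; rewrite le_eqVlt => /predU1P[<-|s0].
    by have := C0 0; rewrite !mulr0; apply; rewrite lexx ler01.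
  have Ps0 : (0 < vol (P s))%E by rewrite P_gt0// s0.
  have := H (b s) i (b01 s s01) Ps0; rewrite bi -/u -/(G s) => GV.
  have := le_trans GV (V_le k s s01 IH).
  have -> : C / 2 ^+ k * s ^+ 2 / 2 = s * (C / 2 ^+ k.+1 * s).
    by rewrite [2 ^+ k.+1]exprS; field; rewrite expf_neq0.
  by rewrite EFinM lee_pmul2l.
have P1 : (0 < vol (P 1%R))%E by rewrite P_gt0// ltr01 lexx.
have one01 : ((0 : R) <= (1 : R) <= (1 : R))%R.
  by rewrite lexx ler01.
have V1 k : (vol (P 1%R) <= (C / 2 ^+ k.+1)%:E)%E.
  have := V_le k 1 one01 (G_le k); rewrite expr1n mulr1 exprSr invfM mulrA.
  by [].
have Vfin : vol (P 1) \is a fin_num.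
  by rewrite ge0_fin_numE ?vol_ge0//; exact: le_lt_trans (V1 0) (ltry _).
move: P1 V1; rewrite -(fineK Vfin); set v := fine _; rewrite lte_fin => v0 V1.
(* As [2 ^ k.+1] exceeds [k], the bound [C / 2 ^ k.+1] falls below the volume [v]. *)
pose k := Num.bound `|C / v|.
have := V1 k; rewrite lee_fin ler_pdivlMr ?exprn_gt0// leNgt => /negP; apply.
rewrite mulrC -ltr_pdivrMr//; apply: (le_lt_trans (ler_norm _)).
apply: (lt_le_trans (archi_boundP (normr_ge0 _))).
by rewrite -natrX ler_nat -/k ltnW// ltnW// ltn_expl.
Qed.

End polytopes.

(** * Positive spanning sets *)

Section positive_spanning.
Variable R : realType.

Lemma ltW_or0 (x : R) : 0 <= x -> x = 0 \/ 0 < x.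
Proof. by rewrite le_eqVlt => /predU1P[<-|]; [left|right]. Qed.

(* Caratheodory's theorem for cones: a combination with minimal support involves
   linearly independent vectors only, and these lie in an open half-space. *)
Lemma pos_hull_pointed n m (U : 'M[R]_(n, m)) z : pos_hull U z ->
  exists (c : 'I_m -> R) x, [/\ forall j, 0 <= c j,
    \sum_j c j *: col j U = z & forall j, 0 < c j -> dot (col j U) x < 0].
Proof.
move=> [c [c0 zE]].
have [k] := ubnP #|[set j | 0 < c j]%SET|; elim: k c c0 zE => // k IH c c0 zE.
set S := [set j | 0 < c j]%SET => Sk.
pose W : 'M[R]_(#|S|, n) := \matrix_(a, i) U i (enum_val a).
have [Wfree|] := boolP (row_free W).
  exists c, (pinvmx W *m const_mx (-1)); split => // j cj.
  have jS : j \in S by rewrite inE.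
  have -> : col j U = (row (enum_rank_in jS j) W)^T.
    by apply/colP => i; rewrite !mxE enum_rankK_in.
  (* For independent rows the system [W x = -1] is solvable, and its solution is the required
     [x]. *)
  rewrite dotE trmxK -row_mul mulmxA mulmxVp// mul1mx !mxE.
  by rewrite oppr_lt0.
rewrite -kermx_eq0 => /rowV0Pn[d /sub_kermxP dW d0].
(* A relation may be negated, so some coefficient can be taken positive. *)
wlog [a0 da0] : d dW d0 / exists a, 0 < d 0 a.
  move=> wl; have [|dneg] := pselect (exists a, 0 < d 0 a); first exact: wl dW d0.
  have /rV0Pn[a da] := d0.
  apply: (wl (- d)); first by rewrite mulNmx dW oppr0.
    by rewrite oppr_eq0.
  exists a; rewrite mxE oppr_gt0 lt_neqAle da leNgt.
  by apply/negP => da0; apply: dneg; exists a.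
(* The relation [d], extended by zero from the support of [c] to all indices. *)
pose e j := \sum_(a | enum_val a == j) d 0 a.
have eE a : e (enum_val a) = d 0 a.
  rewrite /e (bigD1 a)//= big1 ?addr0// => b /andP[/eqP/enum_val_inj -> /eqP].
  by [].
have eS j : j \notin S -> e j = 0.
  move=> jS; rewrite /e big1// => a /eqP aj.
  by case/negP: jS; rewrite -aj; exact: enum_valP.
have eU : \sum_j e j *: col j U = 0.
  transitivity (\sum_a d 0 a *: col (enum_val a) U).
    rewrite [RHS](partition_big enum_val xpredT)//=; apply: eq_bigr => j _.
    by rewrite scaler_suml; apply: eq_bigr => a /eqP ->.
  apply/colP => i; rewrite summxE mxE; under eq_bigr do rewrite !mxE.
  have := congr1 (fun M : 'M[R]_(1, n) => M 0 i) dW; rewrite !mxE => dWi.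
  by rewrite -[RHS]dWi; under [RHS]eq_bigr do rewrite mxE.
have e0 : 0 < e (enum_val a0) by rewrite eE.
(* The least ratio [c j / e j] over [e j > 0] is the largest multiple of [e] that can be subtracted
   while keeping [c] non-negative; it kills the coefficient at [j1]. *)
case: (@arg_minP _ _ _ (enum_val a0) (fun j => 0 < e j) (fun j => c j / e j) e0).
move=> j1 ej1 jmin; set th := c j1 / e j1 in jmin *.
have th0 : 0 <= th by rewrite divr_ge0// ltW.
apply: (IH (fun j => c j - th * e j)).
- move=> j; have [ej|ej] := ltP 0 (e j).
    by rewrite subr_ge0 -ler_pdivlMr//; exact: jmin.
  by rewrite subr_ge0 (le_trans _ (c0 j))// mulr_ge0_le0.
- under eq_bigr do rewrite scalerBl -scalerA.
  by rewrite sumrB -scaler_sumr eU scaler0 subr0.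
- apply: leq_trans (Sk : (_ <= k)%N); apply: proper_card.
  apply/properP; split.
    apply/fintype.subsetP => j; rewrite !inE; apply: contraTT => cj.
    by rewrite eS ?inE// mulr0 subr0.
  exists j1; rewrite ?inE.
    by apply: contraTT ej1 => cj; rewrite eS ?inE// ltxx.
  by rewrite /th divfK ?subrr ?ltxx// gt_eqF.
Qed.

End positive_spanning.

(** * From parallel circuits to a basis and its opposite *)

Section opposite_columns.
Variable R : realType.

Lemma sumr_reindex_scale (V : lmodType R) (I J : finType) (g : I -> J)
    (a : I -> R) (v : J -> V) :
  \sum_j (\sum_(k | g k == j) a k) *: v j = \sum_k a k *: v (g k).
Proof.
rewrite [RHS](partition_big g xpredT)//=; apply: eq_bigr => j _.
by rewrite scaler_suml; apply: eq_bigr => k /eqP ->.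
Qed.

Lemma opposite_columns n m (U : 'M[R]_(n, m)) :
  (forall i, dot (col i U) (col i U) = 1) -> injective (fun i => col i U) ->
  pos_hull U = setT ->
  (forall i (c : 'I_m -> R) x, (forall j, 0 <= c j) ->
     \sum_j c j *: col j U = - col i U ->
     (forall j, 0 < c j -> dot (col j U) x < 0) ->
   forall j, 0 < c j -> col j U = col i U \/ col j U = - col i U) ->
  m = (2 * n)%N /\
  exists s : 'S_m, forall i j : 'I_m,
    (i < n)%N -> j = (n + i)%N :> nat -> col (s j) U = - col (s i) U.
Proof.
move=> U1 Uinj UT H.
(* If no column equals [- u_i], every column used in a pointed combination for [- u_i] is [u_i]
   itself, making [- u_i] a non-negative multiple of [u_i]. *)
have /choice[opp oppE] : forall i, exists j, col j U = - col i U.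
  move=> i; have [c [x [c0 cE cx]]] : exists (c : 'I_m -> R) x,
      [/\ forall j, 0 <= c j, \sum_j c j *: col j U = - col i U &
          forall j, 0 < c j -> dot (col j U) x < 0].
    by apply: pos_hull_pointed; rewrite UT.
  have [//|no] := pselect (exists j, col j U = - col i U); exfalso.
  have cE1 : \sum_j c j *: col j U = (\sum_j c j) *: col i U.
    rewrite scaler_suml; apply: eq_bigr => j _.
    have [->|cj] := ltW_or0 (c0 j); first by rewrite !scale0r.
    have [->//|uj] := H i c x c0 cE cx j cj.
    by exfalso; apply: no; exists j.
  have := congr1 (fun z => dot z (col i U)) cE; rewrite /= cE1 dotZl dotNl U1 mulr1.
  by apply/eqP; rewrite gt_eqF// (@lt_le_trans _ _ 0) ?oppr_lt0// sumr_ge0.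
have fU : row_full U^T.
  apply/row_fullP.
  have /choice[B BE] : forall k, exists c : 'I_m -> R,
      \sum_j c j *: col j U = delta_mx k 0.
    move=> k; have [c [_ ->]] : pos_hull U (delta_mx k 0) by rewrite UT.
    by exists c.
  exists (\matrix_(k, j) B k j); apply/matrixP => k l; rewrite !mxE.
  have := congr1 (fun M : 'cV[R]_n => M l 0) (BE k).
  rewrite summxE !mxE eqxx andbT eq_sym => <-.
  by apply: eq_bigr => j _; rewrite !mxE.
pose f := fullrankfun fU; pose W := rowsub f U^T.
have Wunit : W \in unitmx by exact: fullrowsub_unit.
have WE k : row k W = (col (f k) U)^T by apply/rowP => l; rewrite !mxE.
have Wdot (x : 'cV[R]_n) k : dot (col (f k) U) x = (W *m x) k 0.
  by rewrite dotE -WE -row_mul mxE.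
have surj i : exists k, i = f k \/ i = opp (f k).
  (* The coordinates of [- u_i] in the basis [W]. Below, [g] flips the basis vectors with negative
     coordinate, and [x] has product -1 with every flipped vector, so the hypothesis [H] applies. *)
  pose a : 'rV[R]_n := - (col i U)^T *m invmx W.
  have aE : \sum_k a 0 k *: col (f k) U = - col i U.
    apply: trmx_inj; rewrite linear_sum/= linearN/=.
    rewrite -[RHS](mulmxKV Wunit) -/a mulmx_sum_row.
    by apply: eq_bigr => k _; rewrite linearZ/= WE.
  pose g k := if 0 <= a 0 k then f k else opp (f k).
  pose x := invmx W *m \col_k (if 0 <= a 0 k then -1 else 1).
  have gx k : dot (col (g k) U) x < 0.
    rewrite /g; case: ifPn => ak; rewrite ?oppE ?dotNl Wdot mulmxA mulmxV// mul1mx.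
      by rewrite mxE ak ltrN10.
    by rewrite mxE (negPf ak) ltrN10.
  pose c j := \sum_(k | g k == j) `|a 0 k|.
  have [k ak] : exists k, a 0 k != 0.
    apply/rV0Pn; apply: contraTneq isT => a0.
    have := U1 i; rewrite -[X in dot X _]opprK -aE big1 => [|k _].
      by rewrite oppr0 dot0l => /eqP; rewrite eq_sym oner_eq0.
    by rewrite a0 mxE scale0r.
  have : col (g k) U = col i U \/ col (g k) U = - col i U.
    apply: (H i c x).
    - by move=> j; exact: sumr_ge0.
    - rewrite sumr_reindex_scale -aE; apply: eq_bigr => l _; rewrite /g.
      case: ifPn => al; first by rewrite ger0_norm.
      by rewrite oppE scalerN -scaleNr ltr0_norm ?opprK// ltNge.
    - move=> j; have [[l <-]//|no] := pselect (exists l, g l = j).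
      by rewrite /c big1 ?ltxx// => l /eqP gl; case: no; exists l.
    - rewrite /c (bigD1 k)//= ltr_pwDl ?normr_gt0//.
      exact: sumr_ge0.
  move=> gk; exists k; move: gk; rewrite /g; case: ifP => _ [].
  - by move/Uinj => ->; left.
  - by move=> e; right; apply: Uinj; rewrite /= oppE e opprK.
  - by move/Uinj => ->; right.
  - by rewrite oppE => /oppr_inj/Uinj ->; left.
have fN k l : col (f k) U != - col (f l) U.
  apply/eqP => kl; have : (delta_mx 0 k + delta_mx 0 l : 'rV[R]_n) *m W = 0.
    by rewrite mulmxDl -!rowE !WE kl linearN/= addNr.
  move=> /(congr1 (mulmxr (invmx W))); rewrite /= mulmxK// mul0mx.
  move=> /(congr1 (fun M : 'rV[R]_n => M 0 k)); rewrite !mxE !eqxx/=.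
  by apply/eqP; rewrite gt_eqF// ltr_pwDl.
have opp_inj : injective opp.
  by move=> i j e; apply: Uinj; apply: oppr_inj; rewrite /= -!oppE e.
pose h (k : 'I_n + 'I_n) := match k with inl k => f k | inr k => opp (f k) end.
have hinj : injective h.
  move=> [k|k] [l|l] /=.
  - by move/fullrankfun_inj ->.
  - by move=> e; have := fN k l; rewrite e oppE eqxx.
  - by move=> e; have := fN l k; rewrite -e oppE eqxx.
  - by move/opp_inj/fullrankfun_inj ->.
(* The map [h] from two copies of ['I_n] is injective and, by [surj], onto; its values also give the
   renumbering. *)
have mE : m = (n + n)%N.
  have /choice[hi hK] : forall i, exists k, h k = i.
    by move=> i; have [k [->|->]] := surj i; [exists (inl k)|exists (inr k)].
  apply/eqP; rewrite -[X in X == _]card_ord -[in X in _ == X](card_ord n).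
  rewrite -card_sum eqn_leq (leq_card _ hinj) (leq_card hi)//.
  exact: can_inj hK.
split; first by rewrite mul2n -addnn.
have sinj : injective (fun i : 'I_m => h (fintype.split (cast_ord mE i))).
  move=> i j /hinj /(can_inj (@splitK _ _)); exact: cast_ord_inj.
exists (perm sinj) => i j lt_in jE; rewrite !permE.
have -> : cast_ord mE i = lshift n (Ordinal lt_in) by exact: val_inj.
have -> : cast_ord mE j = rshift n (Ordinal lt_in) by exact: val_inj.
rewrite -![lshift _ _]/(unsplit (inl _)) -![rshift _ _]/(unsplit (inr _)).
by rewrite !unsplitK /= oppE.
Qed.

End opposite_columns.

(** * Consequences of Ccv = Pscc *)

Section scaling.
Variable R : realType.

Lemma polytope_scale n m (U : 'M[R]_(n, m)) b c x : 0 < c ->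
  polytope U (c *: b) (c *: x) <-> polytope U b x.
Proof.
by move=> c0; split=> H j; have := H j; rewrite dotZr mxE ler_pM2l.
Qed.

Lemma vol_polytope_scale n m (U : 'M[R]_(n, m)) b c : 0 < c ->
  vol (polytope U (c *: b)) = ((c ^+ n)%:E * vol (polytope U b))%E.
Proof.
move=> c0; rewrite -(vol_scale c0); last exact: colmeasurable_polytope.
by congr (_ * vol _)%E; apply/funext => x; apply/propext; exact: polytope_scale.
Qed.

Lemma hyperplane_vol_facet_scale n m (U : 'M[R]_(n.+1, m)) (b : 'cV[R]_m) i c :
  0 < c ->
  hyperplane_vol (col i U) ((c *: b) i 0) (facet U (c *: b) i) =
  ((c ^+ n)%:E * hyperplane_vol (col i U) (b i 0)%R (facet U b i))%E.
Proof.
move=> c0; rewrite /hyperplane_vol -(vol_scale c0); last first.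
  by apply: colmeasurable_hyperplane; exact: colmeasurable_facet.
congr (_ * vol _)%E; apply/funext => y; apply/propext => /=.
rewrite -scalemxAr mxE -scalerA -scalerDr; set x := b i 0 *: _ + _.
rewrite /facet/= dotZr mxE; split=> -[/(polytope_scale _ _ _ c0) Px].
  by move/(mulfI (lt0r_neq0 c0)).
by move->.
Qed.

(** Supplies the dilation factor that brings a polytope of volume [v] in dimension [n.+1] to volume
    1. *)
Lemma exists_root n (v : R) : 0 < v -> exists2 c, 0 < c & c ^+ n.+1 * v = 1.
Proof.
move=> v0; exists (v^-1 `^ n.+1%:R^-1); first by rewrite powR_gt0// invr_gt0.
rewrite -powR_mulrn ?powR_ge0// -powRrM mulVf// powRr1 ?invr_ge0 ?ltW//.
by rewrite mulVf// gt_eqF.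
Qed.

Lemma Pscc_le n m (U : 'M[R]_(n, m)) x i : Pscc U x -> x i 0 <= n%:R^-1.
Proof.
move=> [_ [k [c [v [c0 c1 vP ->]]]] <-].
rewrite mxE -[leRHS]mulr1 ler_wpM2l ?invr_ge0// summxE -c1.
apply: ler_sum => a _; have [B _ <-] := vP a; rewrite !mxE.
by rewrite ler_piMr//; case: (i \in B).
Qed.

(** After dilation to volume 1, [Pscc_le] bounds the cone volume by [1/(n+1)]. Both sides are
    homogeneous of degree [n.+1], so the dilation can be undone. *)
Lemma Ccv_sub_Pscc_facet n m (U : 'M[R]_(n.+1, m)) :
  (forall j, dot (col j U) (col j U) = 1) -> pos_hull U = setT ->
  Ccv U `<=` Pscc U ->
  forall (b : 'cV[R]_m) i, (forall j, 0 <= b j 0 <= 1) ->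
    (0 < vol (polytope U b))%E ->
    ((b i 0)%:E * hyperplane_vol (col i U) (b i 0)%R (facet U b i) <=
     vol (polytope U b))%E.
Proof.
move=> U1 UT sub b i b01 V0; have [r r0 rP] := polytope_bounded UT.
have Pr : polytope U b `<=` sqball n.+1 (r ^+ 2).
  by apply: rP => j; have /andP[] := b01 j.
have Vfin : vol (polytope U b) \is a fin_num.
  rewrite ge0_fin_numE ?vol_ge0//; apply: le_lt_trans (ltry ((2 * r) ^+ n.+1)).
  by apply: vol_sqball_bounded => //; exact: colmeasurable_polytope.
(* Finiteness ensures that [fine] inside [cone_volume] returns the true facet volume. *)
have Ffin : hyperplane_vol (col i U) (b i 0) (facet U b i) \is a fin_num.
  rewrite ge0_fin_numE ?hyperplane_vol_ge0//.
  apply: le_lt_trans (ltry ((2 * r) ^+ n)); apply: vol_sqball_bounded => //.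
    by apply: colmeasurable_hyperplane; exact: colmeasurable_facet.
  move=> y [/Pr]; rewrite /sqball/= frame_norm// => + _; apply: le_trans.
  by rewrite lerDr sqr_ge0.
move: V0; rewrite -(fineK Vfin); set v := fine _; rewrite lte_fin => v0.
have [c c0 cv] := exists_root n v0.
have : Ccv U (cone_volume U (c *: b)).
  exists (c *: b) => //; split=> [j|].
    by have /andP[? _] := b01 j; rewrite mxE mulr_ge0// ltW.
  by rewrite vol_polytope_scale// -(fineK Vfin) -/v -EFinM cv.
move=> /sub /(Pscc_le i); rewrite 2!mxE hyperplane_vol_facet_scale//.
rewrite -(fineK Ffin) fineM//; set g := fine (hyperplane_vol _ _ _).
rewrite ger_pMr ?invr_gt0// [X in X * _]mxE /= => cbg.
rewrite -EFinM lee_fin -(ler_pM2l (exprn_gt0 n.+1 c0)) cv; apply: le_trans cbg.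
by rewrite exprS le_eqVlt; apply/orP; left; apply/eqP; ring.
Qed.

Lemma Ccv_eq_Pscc_opposite n m (U : 'M[R]_(n.+1, m)) : in_calU U ->
  Ccv U = Pscc U ->
  m = (2 * n.+1)%N /\
  exists s : 'S_m, forall i j : 'I_m,
    (i < n.+1)%N -> j = (n.+1 + i)%N :> nat -> col (s j) U = - col (s i) U.
Proof.
move=> [U1 Uinj UT] CP.
have {}U1 j : dot (col j U) (col j U) = 1 by exact: enorm_eq1.
apply: opposite_columns => // i c x c0 cE cx.
apply: (positive_circuit_parallel U1 UT _ c0 cE cx).
by apply: Ccv_sub_Pscc_facet => //; rewrite CP.
Qed.

End scaling.

(** * Opposite pairs of normals *)

Section parallelepipeds.
Variable R : realType.

Lemma conv_hull_fin (V : lmodType R) (A : set V) (I : finType) (c : I -> R)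
    (v : I -> V) : (forall i, 0 <= c i) -> \sum_i c i = 1 ->
  (forall i, A (v i)) -> conv_hull A (\sum_i c i *: v i).
Proof.
move=> c0 c1 Av; exists #|I|, (c \o enum_val), (v \o enum_val); split => /=.
- by move=> k; exact: c0.
- by rewrite -c1 [RHS](reindex _ (onW_bij _ (@enum_val_bij I))).
- by move=> k; exact: Av.
- by rewrite (reindex _ (onW_bij _ (@enum_val_bij I))).
Qed.

(** Independent choices with probabilities [q i] have marginal [q k] at [k]: the indicator is
    absorbed into factor [k], and the sum of products becomes a product of sums. *)
Lemma product_weights_marginal (I : finType) (q : I -> bool -> R) k e :
  (forall i, q i true + q i false = 1) ->
  \sum_(ep : {ffun I -> bool}) (\prod_i q i (ep i)) * (ep k == e)%:R = q k e.
Proof.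
move=> q1.
pose F i a := q i a * (if i == k then (a == e)%:R else 1).
transitivity (\sum_(ep : {ffun I -> bool}) \prod_i F i (ep i)).
  apply: eq_bigr => ep _; rewrite big_split/=; congr (_ * _).
  by rewrite (bigD1 k)//= eqxx big1 ?mulr1// => i /negPf ->.
rewrite -bigA_distr_bigA/= (bigD1 k)//= [X in _ * X]big1 ?mulr1 => [|i ik].
  rewrite big_bool {}/F eqxx.
  by case: e; rewrite /= mulr1 mulr0 ?addr0 ?add0r.
by rewrite big_bool /F (negPf ik)/= !mulr1; exact: q1.
Qed.

Section opposite_pairs.
Context n m (U : 'M[R]_(n.+1, m)) (opp : 'I_m -> 'I_m) (f : 'I_n.+1 -> 'I_m).
Hypotheses (U1 : forall j, dot (col j U) (col j U) = 1)
  (Uinj : injective (fun j => col j U)) (UT : pos_hull U = setT)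
  (oppE : forall j, col (opp j) U = - col j U)
  (f_surj : forall j, exists k, j = f k \/ j = opp (f k)).

Lemma oppK : involutive opp.
Proof. by move=> j; apply: Uinj; rewrite /= !oppE opprK. Qed.

Lemma pair_span z : exists a : 'I_n.+1 -> R, z = \sum_k a k *: col (f k) U.
Proof.
have [c [_ zE]] : pos_hull U z by rewrite UT.
have /choice[a aE] : forall j, exists a : 'I_n.+1 -> R,
    col j U = \sum_k a k *: col (f k) U.
  move=> j; have [k jk] := f_surj j.
  exists (fun l => if l == k then (if j == f k then 1 else -1) else 0).
  rewrite (bigD1 k)//= eqxx big1 ?addr0 => [|l /negPf ->]; last by rewrite scale0r.
  case: eqP jk => [-> _|jk []//->]; first by rewrite scale1r.
  by rewrite oppE scaleN1r.
exists (fun k => \sum_j c j * a j k); rewrite zE.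
under [RHS]eq_bigr do rewrite scaler_suml.
rewrite exchange_big/=; apply: eq_bigr => j _; rewrite {1}aE scaler_sumr.
by apply: eq_bigr => k _; rewrite scalerA.
Qed.

Let W : 'M[R]_n.+1 := \matrix_(k, i) U i (f k).

Let Wunit : W \in unitmx.
Proof.
have /choice[B BE] : forall k : 'I_n.+1, exists a : 'I_n.+1 -> R,
    delta_mx k 0 = \sum_l a l *: col (f l) U by move=> k; exact: pair_span.
suff : (\matrix_(k, l) B k l) *m W = 1%:M by move=> /mulmx1_unit[].
apply/matrixP => k i; rewrite !mxE.
have := congr1 (fun M : 'cV[R]_n.+1 => M i 0) (BE k).
rewrite summxE !mxE eqxx andbT eq_sym => ->.
by apply: eq_bigr => j _; rewrite !mxE.
Qed.

Lemma pair_solve (y : 'I_n.+1 -> R) : exists x, forall k, dot (col (f k) U) x = y k.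
Proof.
exists (invmx W *m \col_k y k) => k.
have -> : col (f k) U = (row k W)^T by apply/colP => i; rewrite !mxE.
by rewrite dotE trmxK -row_mul mulmxA mulmxV// mul1mx !mxE.
Qed.

(** Such a [z] is an edge direction of the parallelepiped: moving along it affects only the
    constraints [j] and [opp j]. *)
Lemma pair_dual j : exists z, dot (col j U) z = 1 /\
  forall l, l != j -> l != opp j -> dot (col l U) z = 0.
Proof.
have [k jk] := f_surj j.
have [z zE] := pair_solve (fun l => (l == k)%:R).
have z0 l : l != f k -> l != opp (f k) -> dot (col l U) z = 0.
  have [l' [->|->]] := f_surj l; rewrite ?oppE ?dotNl zE => l1 l2.
    by have [lk|//] := eqVneq l' k; rewrite lk eqxx in l1.
  by have [lk|_] := eqVneq l' k; [rewrite lk eqxx in l2|rewrite oppr0].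
case: jk => ->; first by exists z; split; [rewrite zE eqxx|exact: z0].
exists (- z); split; first by rewrite dotNr oppE dotNl zE eqxx opprK.
by move=> l l1 l2; rewrite dotNr z0 ?oppr0//; rewrite oppK in l2.
Qed.

Lemma opp_neq j : opp j != j.
Proof.
apply/eqP => jj; have := U1 j; rewrite -{1}jj oppE dotNl U1.
by apply/eqP; rewrite lt_eqF// (@lt_trans _ _ 0)// oppr_lt0.
Qed.

Lemma f_neq_opp k l : f k != opp (f l).
Proof.
apply/eqP => kl; have [x xE] := pair_solve (fun=> 1).
have := xE k; rewrite kl oppE dotNl xE.
by apply/eqP; rewrite lt_eqF// (@lt_trans _ _ 0)// oppr_lt0.
Qed.

Lemma f_inj : injective f.
Proof.
move=> k l kl; have [x xE] := pair_solve (fun i => (i == k)%:R).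
by have := xE k; rewrite kl xE eqxx; case: eqP => // _ /eqP; rewrite eq_sym oner_eq0.
Qed.

(** All slices orthogonal to [u_i] between the two opposite facets are translates of the facet along
    the edge direction, and the height is [b_i + b_(opp i)]. *)
Lemma vol_parallelepiped (b : 'cV[R]_m) i : (forall j, 0 <= b j 0) ->
  vol (polytope U b) = (hyperplane_vol (col i U) (b i 0)%R (facet U b i) *
                        (b i 0 + b (opp i) 0)%:E)%E.
Proof.
move=> b0; set u := col i U; have u1 : dot u u = 1 := U1 i.
have Pi x : polytope U b x -> dot u x \in `[- b (opp i) 0, b i 0].
  move=> Px; rewrite in_itv/= (Px i) andbT lerNl -dotNl -oppE.
  exact: Px.
rewrite -[b (opp i) 0]opprK; apply: (vol_slices_const u1 _ _ Pi).
- by rewrite (@le_trans _ _ 0)// oppr_le0.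
- exact: colmeasurable_polytope.
move=> s; rewrite in_itv/= => /andP[s1 s2].
have [z [z1 z0]] := pair_dual i; rewrite -/u in z1.
pose Q := hyperplane_frame u; have [QQ Qu] := hyperplane_frameP u1.
pose y0 := Q^T *m z.
(* As [dot u z = 1], moving by [(b i 0 - s) *: z] lifts height [s] to [b i 0], and in frame
   coordinates it is a translation along [y0]. *)
have zE : z = u + Q *m y0.
  have uQ x : dot u (Q *m x) = 0 by rewrite dot_mulmx Qu dot0l.
  apply/eqP; rewrite -subr_eq; apply/eqP.
  have := @kernel_frame _ _ u u1 (z - Q *m y0).
  rewrite mulmxBr [_ *m (Q *m y0)]mulmxA QQ mul1mx subrr => /(_ erefl) ->.
  by rewrite dotDr dotNr uQ subr0 z1 scale1r.
pose A := [set y | facet U b i (b i 0 *: u + Q *m y)].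
have mA : colmeasurable A.
  by apply: colmeasurable_hyperplane; exact: colmeasurable_facet.
rewrite -[RHS](vol_translate ((b i 0 - s) *: y0) mA); congr vol.
apply/funext => y; apply/propext; rewrite /A/=.
have -> : b i 0 *: u + Q *m (y + (b i 0 - s) *: y0) =
    (s *: u + Q *m y) + (b i 0 - s) *: z.
  rewrite zE mulmxDr -scalemxAr scalerDr [RHS]addrACA.
  by rewrite -scalerDl [s + _]addrC subrK.
set x := s *: u + Q *m y.
have xu : dot u x = s by exact: frame_normal.
rewrite /facet/= dotDr dotZr z1 mulr1 xu; split=> [Px|[Px _] j].
  split; last by rewrite addrC subrK.
  move=> j; rewrite dotDr dotZr; have [->|ji] := eqVneq j i.
    by rewrite z1 mulr1 -/u xu addrC subrK.
  have [->|joi] := eqVneq j (opp i).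
    rewrite oppE !dotNl z1 -/u xu; have := b0 i; have := b0 (opp i); lra.
  by rewrite z0// mulr0 addr0.
have [->|ji] := eqVneq j i; first by rewrite -/u xu.
have [->|joi] := eqVneq j (opp i); first by rewrite oppE dotNl -/u xu lerNl.
by have := Px j; rewrite dotDr dotZr z0// mulr0 addr0.
Qed.

Lemma cone_volume_parallelepiped (b : 'cV[R]_m) i : (forall j, 0 <= b j 0) ->
  vol (polytope U b) = 1%E ->
  b i 0 + b (opp i) 0 != 0 /\
  cone_volume U b i 0 = n.+1%:R^-1 * (b i 0 / (b i 0 + b (opp i) 0)).
Proof.
move=> b0; rewrite (vol_parallelepiped i b0) !mxE.
set g := hyperplane_vol _ _ _; set w := _ + b (opp i) 0.
have : (0 <= g)%E by exact: hyperplane_vol_ge0.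
have w0 : 0 <= w by rewrite addr_ge0.
(* A width of zero would give volume 0, even for an infinite [g], as [+oo * 0 = 0]. *)
have [->|wn0] := eqVneq w 0.
  by move=> _; rewrite mule0 => /eqP; rewrite eqe eq_sym oner_eq0.
have {w0}wn0 : 0 < w by rewrite lt_neqAle eq_sym wn0.
case: g => [g||] //= _; last by rewrite gt0_mulye ?lte_fin.
move=> /eqP; rewrite eqe => /eqP gw; split; first by [].
by congr (_ * (_ * _)); rewrite -[LHS](mulfK (lt0r_neq0 wn0)) gw mul1r.
Qed.

Lemma is_basis_setE B : is_basis_set U B =
  (fullv <= <<[seq col i U | i <- enum B]>>)%VS && (#|B| <= n.+1)%N.
Proof.
rewrite /is_basis_set basisEdim size_map -cardE; congr (_ && (_ <= _)%N).
by rewrite dimvf /dim/= muln1.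
Qed.

Lemma spanning_set_card (B : {set 'I_m}) :
  (fullv <= <<[seq col i U | i <- enum B]>>)%VS -> (n < #|B|)%N.
Proof.
move=> /dimvS; rewrite dimvf /dim/= muln1 => /leq_trans; apply.
by apply: leq_trans (dim_span _) _; rewrite size_map -cardE.
Qed.

(** If both were missing, the dual vector of [j] would annihilate all of [B] but not [u_j]. *)
Lemma spanning_set_pair (B : {set 'I_m}) j :
  (fullv <= <<[seq col i U | i <- enum B]>>)%VS -> (j \in B) || (opp j \in B).
Proof.
move=> /subvP /(_ (col j U) (memvf _)) /(@coord_span _ _ _ (in_tuple _)) jE.
have [z [z1 z0]] := pair_dual j; apply: contraT; rewrite negb_or => /andP[jB ojB].
have := z1; rewrite jE dot_suml big1 => [/eqP|k _]; first by rewrite eq_sym oner_eq0.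
have /mapP[l] := mem_nth 0 (ltn_ord k : (k < size [seq col i U | i <- enum B])%N).
rewrite mem_enum dotZl => lB ->; rewrite z0 ?mulr0//.
  by apply: contraTneq lB => ->.
by apply: contraTneq lB => ->.
Qed.

(** If a basis contained both, dropping [opp j] would leave a spanning set with too few elements. *)
Lemma basis_set_pair (B : {set 'I_m}) j : is_basis_set U B ->
  ((j \in B) + (opp j \in B))%N = 1%N.
Proof.
rewrite is_basis_setE => /andP[Bspan Bcard].
have := spanning_set_pair j Bspan.
case: (boolP (j \in B)) => jB; case: (boolP (opp j \in B)) => ojB //= _.
have : (n < #|B :\ opp j|)%N.
  apply: spanning_set_card; apply: (subv_trans Bspan).
  have B'mem k : k \in B :\ opp j ->
      col k U \in <<[seq col i U | i <- enum (B :\ opp j)]>>%VS.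
    by move=> kB; apply/memv_span/map_f; rewrite mem_enum.
  apply/span_subvP => _ /mapP[k + ->]; rewrite mem_enum => kB.
  have [->|koj] := eqVneq k (opp j).
    by rewrite oppE memvN B'mem// !inE eq_sym opp_neq jB.
  by rewrite B'mem// !inE koj.
by move: Bcard; rewrite (cardsD1 (opp j) B) ojB add1n => /leq_trans h /h; rewrite ltnn.
Qed.

Lemma choice_basis_set (ep : {ffun 'I_n.+1 -> bool}) :
  is_basis_set U [set j | [exists k, j == if ep k then f k else opp (f k)]]%SET.
Proof.
set g := fun k => if ep k then f k else opp (f k).
have -> : [set j | [exists k, j == g k]]%SET = [set g k | k in 'I_n.+1]%SET.
  apply/setP => j; rewrite inE.
  apply/existsP/imsetP => [[k /eqP ->]|[k _ ->]]; by exists k.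
rewrite is_basis_setE (leq_trans (leq_imset_card _ _)) ?card_ord// andbT.
apply/subvP => z _; have [a ->] := pair_span z.
apply: memv_suml => k _; apply: memvZ.
have gk : col (g k) U \in
    <<[seq col i U | i <- enum [set g k | k in 'I_n.+1]%SET]>>%VS.
  by apply/memv_span/map_f; rewrite mem_enum; apply/imsetP; exists k.
by move: gk; rewrite {1}/g; case: ifP => // _; rewrite oppE memvN.
Qed.

(** A basis takes one vector from each pair, which gives the equations. Conversely, [p] is the mean
    of the random basis that picks [f k] with probability [p (f k) 0], independently for each
    [k]. *)
Lemma Pscc_pairs x : Pscc U x <->
  exists p : 'cV[R]_m, [/\ forall j, 0 <= p j 0,
    forall j, p j 0 + p (opp j) 0 = 1 & x = n.+1%:R^-1 *: p].
Proof.
split=> [[p [k [c [v [c0 c1 vB pE]]]] <-]|[p [p0 p1 ->]]].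
  exists p; split=> //; rewrite pE => j.
    rewrite summxE; apply: sumr_ge0 => a _; have [B _ <-] := vB a.
    by rewrite !mxE mulr_ge0.
  rewrite !summxE -big_split/= -[RHS]c1; apply: eq_bigr => a _.
  have [B BB <-] := vB a; rewrite !mxE -mulrDr -natrD basis_set_pair//.
  by rewrite mulr1.
exists p => //.
pose q (k : 'I_n.+1) (e : bool) := if e then p (f k) 0 else p (opp (f k)) 0.
have q1 k : q k true + q k false = 1 by exact: p1.
pose B (ep : {ffun 'I_n.+1 -> bool}) :=
  [set j | [exists k, j == if ep k then f k else opp (f k)]]%SET.
have -> : p = \sum_(ep : {ffun 'I_n.+1 -> bool})
    (\prod_k q k (ep k)) *: char_vec R (B ep).
  apply/colP => j; rewrite summxE; have [k jk] := f_surj j.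
  (* For [j] in pair [k], the value [j == f k] tells which member of the pair [j] is. *)
  have jB ep : (j \in B ep) = (ep k == (j == f k)).
    rewrite inE; apply/existsP/eqP => [[l /eqP jl]|epk].
      case epl: (ep l) jl => jl.
        case: jk => jk; last by have := f_neq_opp l k; rewrite -jl jk eqxx.
        by move: jl; rewrite jk eqxx => /f_inj ->; exact: epl.
      case: jk => jk; first by have := f_neq_opp k l; rewrite -jl jk eqxx.
      move: jl; rewrite jk => /(can_inj oppK)/f_inj ->; rewrite epl.
      by apply/esym/negbTE; rewrite eq_sym f_neq_opp.
    exists k; rewrite epk; have [->//|jf] := eqVneq j (f k).
    by case: jk => jk; [rewrite jk eqxx in jf|rewrite jk].
  under eq_bigr do rewrite !mxE jB.
  rewrite product_weights_marginal// /q; case: eqP => [->//|jf].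
  by case: jk => [//|->].
apply: conv_hull_fin => [ep||ep].
- by apply: prodr_ge0 => k _; rewrite /q; case: ifP.
- rewrite -(bigA_distr_bigA (fun k e => q k e)) big1// => k _.
  by rewrite big_bool/=; exact: p1.
- by exists (B ep) => //=; exact: choice_basis_set.
Qed.

(** At volume 1 the cone volumes are the ratios [b_j / (b_j + b_(opp j))] divided by the dimension.
    A point [p] with pair sums 1 is its own vector of ratios, so a multiple of [p] serves as [b]. *)
Lemma opposite_pairs_Ccv : Ccv U = Pscc U.
Proof.
apply/seteqP; split=> x.
  move=> [b [b0 b1] <-]; apply/Pscc_pairs.
  exists (\col_j (b j 0 / (b j 0 + b (opp j) 0))); split=> [j|j|].
  - by rewrite mxE divr_ge0// addr_ge0.
  - have [w0 _] := cone_volume_parallelepiped j b0 b1.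
    by rewrite !mxE oppK [b (opp j) 0 + _]addrC -mulrDl divff.
  - apply/colP => j; have [_ ->] := cone_volume_parallelepiped j b0 b1.
    by rewrite !mxE.
move=> /Pscc_pairs[p [p0 p1 ->]].
(* The centre of the parallelepiped [polytope U p], where every constraint has slack 1/2. *)
have [x0 x0E] := pair_solve (fun k => (p (f k) 0 - p (opp (f k)) 0) / 2).
have xE j : dot (col j U) x0 = (p j 0 - p (opp j) 0) / 2.
  have [k [->|->]] := f_surj j; rewrite ?oppE ?dotNl x0E// oppK.
  by rewrite -mulNr opprB.
have V0 : (0 < vol (polytope U p))%E.
  by apply: (@vol_polytope_gt0 _ _ _ _ _ x0) => j; rewrite xE; have := p1 j; lra.
have [r r0 rP] := polytope_bounded UT.
have Vfin : vol (polytope U p) \is a fin_num.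
  rewrite ge0_fin_numE ?vol_ge0//; apply: le_lt_trans (ltry ((2 * r) ^+ n.+1)).
  apply: vol_sqball_bounded => //; first exact: colmeasurable_polytope.
  by apply: rP => j; have := p1 j; have := p0 (opp j); lra.
move: V0; rewrite -(fineK Vfin); set v := fine _; rewrite lte_fin => v0.
have [c c0 cv] := exists_root n v0.
have b0 j : 0 <= (c *: p) j 0 by rewrite mxE mulr_ge0// ltW.
have b1 : vol (polytope U (c *: p)) = 1%E.
  by rewrite vol_polytope_scale// -(fineK Vfin) -/v -EFinM cv.
exists (c *: p) => //; apply/colP => j.
have [_ ->] := cone_volume_parallelepiped j b0 b1.
by rewrite !mxE -mulrDr p1 mulr1 mulrAC divff ?mul1r// gt_eqF.
Qed.

End opposite_pairs.
End parallelepipeds.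

(** * Assembly of the two directions *)

Theorem theorem1p2 (R : realType) (n m : nat) (hn : (0 < n)%N)
    (U : 'M[R]_(n, m)) (hU : in_calU U) :
  Ccv U = Pscc U <->
  m = (2 * n)%N /\
  exists s : 'S_m, forall i j : 'I_m,
    (i < n)%N -> j = (n + i)%N :> nat -> col (s j) U = - col (s i) U.
Proof.
case: n hn U hU => // n _ U hU; split; first exact: Ccv_eq_Pscc_opposite.
move=> [mE [s sE]]; have [U1 Uinj UT] := hU.
have lt_m (k : 'I_n.+1) : (k < m)%N by rewrite mE (leq_trans (ltn_ord k))// leq_pmull.
have lt_m' (k : 'I_n.+1) : (n.+1 + k < m)%N by rewrite mE mul2n -addnn ltn_add2l.
pose f k := s (Ordinal (lt_m k)); pose f' k := s (Ordinal (lt_m' k)).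
have f'E k : col (f' k) U = - col (f k) U by apply: sE => /=.
(* Undoing the renumbering, an index below [n.+1] comes from [f], any other from [f']. *)
have f_cover j : exists k, j = f k \/ j = f' k.
  pose i := (s^-1)%g j; have ji : j = s i by rewrite permKV.
  have [i_lt|i_ge] := ltnP i n.+1.
    by exists (Ordinal i_lt); left; rewrite ji; congr (s _); exact: val_inj.
  have i_lt : (i - n.+1 < n.+1)%N.
    by rewrite ltn_subLR// addnn -mul2n -mE.
  exists (Ordinal i_lt); right; rewrite ji; congr (s _).
  by apply: val_inj; rewrite /= subnKC.
have /choice[opp oppE] : forall j, exists j', col j' U = - col j U.
  move=> j; have [k [->|->]] := f_cover j; first by exists (f' k).
  by exists (f k); rewrite f'E opprK.
apply: (opposite_pairs_Ccv (opp := opp) (f := f)) => // [j|j].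
  exact: enorm_eq1.
have [k [->|->]] := f_cover j; exists k; [by left|right].
by apply: Uinj; rewrite /= oppE f'E.
Qed.
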